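(* There are the following natural isomorphisms (in (1) and (2), natural isomorphisms of semi-functors): (1) $\mathsf{Clop}\circ\mathbb{V}^{\mathsf R}_\Box\simeq\mathbb{K}^{\mathsf S}_\Box\circ\mathsf{Clop}$ and $\mathsf{Uf}\circ\mathbb{K}^{\mathsf S}_\Box\simeq\mathbb{V}^{\mathsf R}_\Box\circ\mathsf{Uf}$. (2) $\mathsf{Clop}\circ\mathbb{V}^{\mathsf R}_\Diamond\simeq\mathbb{K}^{\mathsf S}_\Diamond\circ\mathsf{Clop}$ and $\mathsf{Uf}\circ\mathbb{K}^{\mathsf S}_\Diamond\simeq\mathbb{V}^{\mathsf R}_\Diamond\circ\mathsf{Uf}$. (3) $\mathsf{Clop}\circ\mathbb{V}^{\mathsf R}\simeq\mathbb{K}^{\mathsf S}\circ\mathsf{Clop}$ and $\mathsf{Uf}\circ\mathbb{K}^{\mathsf S}\simeq\mathbb{V}^{\mathsf R}\circ\mathsf{Uf}$. Here $\mathsf{Clop}\colon\mathsf{Stone}^{\mathsf R}\to\mathsf{BA}^{\mathsf S}$ and $\mathsf{Uf}\colon\mathsf{BA}^{\mathsf S}\to\mathsf{Stone}^{\mathsf R}$, the (semi-)functors $\mathbb{V}^{\mathsf R}_\Box,\mathbb{V}^{\mathsf R}_\Diamond,\mathbb{V}^{\mathsf R}$ act on $\mathsf{Stone}^{\mathsf R}$, and $\mathbb{K}^{\mathsf S}_\Box,\mathbb{K}^{\mathsf S}_\Diamond,\mathbb{K}^{\mathsf S}$ act on $\mathsf{BA}^{\mathsf S}$.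
   Context: Relations $R\colon X\to Y$ are subsets of $X\times Y$; composition is $x\,(T\circ R)\,z$ iff $\exists y$ with $x\,R\,y$ and $y\,T\,z$. $\mathsf{Stone}^{\mathsf R}$ is the category of Stone spaces and closed relations ($R\subseteq X\times Y$ closed), with identity relations as identities and relation composition. A subordination relation $S\colon A\to B$ between boolean algebras is a relation $S\subseteq A\times B$ such that for all $a,b\in A$, $c,d\in B$: (S1) $0\,S\,0$ and $1\,S\,1$; (S2) $a\,S\,c$ and $b\,S\,c$ imply $(a\vee b)\,S\,c$; (S3) $a\,S\,c$ and $a\,S\,d$ imply $a\,S\,(c\wedge d)$; (S4) $a\le b\,S\,c\le d$ implies $a\,S\,d$. $\mathsf{BA}^{\mathsf S}$ is the category of boolean algebras and subordination relations; the identity on $B$ is $\le$, and composition is relation composition. $\mathsf{BA}^{\mathsf S}(A,B)$ is the set of subordinations $A\to B$ ordered by inclusion; it is a complete lattice. The functors $\mathsf{Clop}$ and $\mathsf{Uf}$ (quasi-inverse equivalences) act on objects as the clopen-algebra and ultrafilter-space constructions of Stone duality. For a closed relation $R\colon X\to Y$, $\mathsf{Clop}(R)=S_R\colon\mathsf{Clop}(X)\to\mathsf{Clop}(Y)$ with $U\,S_R\,V$ iff $R[U]\subseteq V$. For a subordination $S\colon A\to B$, $\mathsf{Uf}(S)=R_S\colon\mathsf{Uf}(A)\to\mathsf{Uf}(B)$ with $x\,R_S\,y$ iff $S[x]\subseteq y$. For a compact Hausdorff space $X$, $\mathbb{V}(X)$ is the set of all closed subsets of $X$ with the topology generated by the sets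 $\Box_U=\{F\mid F\subseteq U\}$ and $\Diamond_U=\{F\mid F\cap U\ne\varnothing\}$, $U$ open in $X$; it is a Stone space if $X$ is. For a closed relation $R\colon X\to Y$, define relations from $\mathbb{V}(X)$ to $\mathbb{V}(Y)$: $F\,\mathcal{R}_\Box\,G$ iff $G\subseteq R[F]$; $F\,\mathcal{R}_\Diamond\,G$ iff $F\subseteq R^{-1}[G]$; $\mathcal{R}_{EM}=\mathcal{R}_\Box\cap\mathcal{R}_\Diamond$. $\mathbb{V}^{\mathsf R}_\Box,\mathbb{V}^{\mathsf R}_\Diamond,\mathbb{V}^{\mathsf R}$ send $X$ to $\mathbb{V}(X)$ and $R$ to $\mathcal{R}_\Box,\mathcal{R}_\Diamond,\mathcal{R}_{EM}$ respectively; the first two are semi-functors (preserve composition but not necessarily identities), the third is a functor. For a boolean algebra $B$, $\mathbb{K}(B)$ is the quotient of the free boolean algebra over the symbols $\{\Box_a\mid a\in B\}\cup\{\Diamond_a\mid a\in B\}$ by the relations $\Box_1=1$, $\Diamond_0=0$, $\Box_{a\wedge b}=\Box_a\wedge\Box_b$, $\Diamond_{a\vee b}=\Diamond_a\vee\Diamond_b$, $\Box_{a\vee b}\le\Box_a\vee\Diamond_b$, $\Box_a\wedge\Diamond_b\le\Diamond_{a\wedge b}$. An element of $\mathbb{K}(B)$ is in disjunctive normal form if written as a finite join $\bigvee_{i=1}^n(\Box_{a_i}\wedge\Diamond_{b_{i1}}\wedge\cdots\wedge\Diamond_{b_{in_i}})$ with $0\neq b_{ij}\le a_i$; in conjunctive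 normal form if written as a finite meet $\bigwedge_{j=1}^m(\Diamond_{c_j}\vee\Box_{d_{j1}}\vee\cdots\vee\Box_{d_{jm_j}})$ with $c_j\le d_{jk}\neq1$ (empty joins/meets allowed). For a subordination $S\colon A\to B$, define $\mathcal{S}_\Box,\mathcal{S}_\Diamond\colon\mathbb{K}(A)\to\mathbb{K}(B)$: $x\,\mathcal{S}_\Box\,y$ iff $x,y$ can be written in disjunctive, resp. conjunctive, normal form so that for all $i,j$ there is $k\le m_j$ with $a_i\,S\,d_{jk}$; $x\,\mathcal{S}_\Diamond\,y$ iff $x,y$ can be so written that for all $i,j$ there is $l\le n_i$ with $b_{il}\,S\,c_j$. These are subordinations; $\mathcal{S}=\mathcal{S}_\Box\vee\mathcal{S}_\Diamond$ is their join in $\mathsf{BA}^{\mathsf S}(\mathbb{K}(A),\mathbb{K}(B))$. $\mathbb{K}^{\mathsf S}_\Box,\mathbb{K}^{\mathsf S}_\Diamond,\mathbb{K}^{\mathsf S}$ send $B$ to $\mathbb{K}(B)$ and $S$ to $\mathcal{S}_\Box,\mathcal{S}_\Diamond,\mathcal{S}$ respectively; the first two are semi-functors, the third is a functor. For semi-functors $F,G\colon\mathsf{D}\to\mathsf{E}$, a natural transformation $\alpha\colon F\to G$ assigns to each object $D$ a morphism $\alpha_D\colon F(D)\to G(D)$ such that $G(f)\circ\alpha_D=\alpha_{D'}\circ F(f)$ for every $f\colon D\to D'$, and $\alpha_D\circ F(\mathrm{id}_D)=\alpha_D=G(\mathrm{id}_D)\circ\alpha_D$ for every $D$. Composition is componentwise.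 The identity natural transformation $1_F$ has components $(1_F)_D=F(\mathrm{id}_D)$. $F\simeq G$ (naturally isomorphic) means there are natural transformations $\alpha\colon F\to G$, $\beta\colon G\to F$ with $\alpha\circ\beta=1_G$ and $\beta\circ\alpha=1_F$. *)

(* Defs.v *)
From HB Require Import structures.
From mathcomp Require Import all_boot all_order finmap generic_quotient.
From mathcomp Require Import boolp classical_sets filter topology.

Set Implicit Arguments.
Unset Strict Implicit.
Unset Printing Implicit Defensive.

Import Order.Theory.
Local Open Scope classical_set_scope.

Definition Rel (A B : Type) := A -> B -> Prop.

Definition rcomp A B C (T : Rel B C) (R : Rel A B) : Rel A C :=
  fun x z => exists y, R x y /\ T y z.

(* A category whose objects have carriers, whose morphisms [X -> Y] are the
   relations between carriers selected by [ismor], and whose composition is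
   relation composition (hence associative).  The identity of [X] need not be
   the equality relation. *)
Record relCat := RelCat {
  ob :> Type;
  carrier : ob -> Type;
  ismor : forall X Y : ob, Rel (carrier X) (carrier Y) -> Prop;
  idr : forall X : ob, Rel (carrier X) (carrier X);
  ismor_id : forall X, ismor (@idr X);
  ismor_comp : forall X Y Z (R : Rel (carrier X) (carrier Y))
    (T : Rel (carrier Y) (carrier Z)),
    ismor R -> ismor T -> ismor (rcomp T R);
  comp_idr : forall X Y (R : Rel (carrier X) (carrier Y)),
    ismor R -> rcomp R (@idr X) = R;
  comp_idl : forall X Y (R : Rel (carrier X) (carrier Y)),
    ismor R -> rcomp (@idr Y) R = R }.

Arguments ismor {r X Y} R.
Arguments idr {r} X.

(* The data of a (semi-)functor; the action on morphisms is given by a formula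
   that makes sense for every relation between carriers, and the laws
   below only concern the relations that are morphisms. *)
Record fdata (C D : relCat) := FData {
  fob :> C -> D;
  fmor : forall X Y : C,
    Rel (carrier X) (carrier Y) -> Rel (carrier (fob X)) (carrier (fob Y)) }.

Arguments fmor {C D} f {X Y} R.

Definition fcomp (C D E : relCat) (G : fdata D E) (F : fdata C D) :
    fdata C E :=
  @FData C E (fun X => G (F X)) (fun X Y R => fmor G (fmor F R)).

Definition is_semifunctor (C D : relCat) (F : fdata C D) : Prop :=
  (forall (X Y : C) (R : Rel (carrier X) (carrier Y)),
     ismor R -> ismor (fmor F R)) /\
  (forall (X Y Z : C) (R : Rel (carrier X) (carrier Y))
     (T : Rel (carrier Y) (carrier Z)),
     ismor R -> ismor T -> fmor F (rcomp T R) = rcomp (fmor F T) (fmor F R)).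

Definition is_functor (C D : relCat) (F : fdata C D) : Prop :=
  is_semifunctor F /\ forall X : C, fmor F (idr X) = idr (F X).

Definition is_nat (C D : relCat) (F G : fdata C D)
    (alpha : forall X : C, Rel (carrier (F X)) (carrier (G X))) : Prop :=
  [/\ forall X : C, ismor (alpha X),
      forall (X Y : C) (R : Rel (carrier X) (carrier Y)), ismor R ->
        rcomp (fmor G R) (alpha X) = rcomp (alpha Y) (fmor F R),
      forall X : C, rcomp (alpha X) (fmor F (idr X)) = alpha X &
      forall X : C, rcomp (fmor G (idr X)) (alpha X) = alpha X].

(* The identity natural transformation of a semi-functor [F] has components
   [fmor F (idr X)]. *)
Definition nat_iso (C D : relCat) (F G : fdata C D) : Prop :=
  exists (alpha : forall X : C, Rel (carrier (F X)) (carrier (G X)))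
         (beta : forall X : C, Rel (carrier (G X)) (carrier (F X))),
    [/\ is_nat alpha, is_nat beta,
        forall X : C, rcomp (alpha X) (beta X) = fmor G (idr X) &
        forall X : C, rcomp (beta X) (alpha X) = fmor F (idr X)].

Notation "G \oF F" := (fcomp G F) (at level 40, left associativity).
Notation "F ~=~ G" := (nat_iso F G) (at level 70, no associativity).

(* [zero_dimensional] says that clopen sets separate points, which for compact
   Hausdorff spaces amounts to having a basis of clopen sets. *)
Record stoneSpace := StoneSpace {
  stone_sort :> topologicalType;
  stone_compact : compact [set: stone_sort];
  stone_hausdorff : hausdorff_space stone_sort;
  stone_zero_dimensional : zero_dimensional stone_sort }.

Definition closed_rel (X Y : topologicalType) (R : Rel X Y) : Prop :=
  closed [set p : X * Y | R p.1 p.2].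

Definition rimage A B (R : Rel A B) (F : set A) : set B :=
  [set y | exists2 x, F x & R x y].

Definition rpreimage A B (R : Rel A B) (G : set B) : set A :=
  [set x | exists2 y, G y & R x y].

Lemma rcomp_eqr A B (R : Rel A B) : rcomp R (@eq A) = R.
Proof.
apply/funext => x; apply/funext => y; apply/propext; split.
  by move=> [_ [<-]].
by move=> Rxy; exists x.
Qed.

Lemma rcomp_eql A B (R : Rel A B) : rcomp (@eq B) R = R.
Proof.
apply/funext => x; apply/funext => y; apply/propext; split.
  by move=> [z [Rxz <-]].
by move=> Rxy; exists y.
Qed.

Lemma closed_rel_eq (X : stoneSpace) : closed_rel (@eq X).
Proof.
rewrite /closed_rel -[X in closed X]setCK; apply: open_closedC.
rewrite openE => -[x y] /= /eqP /(stone_zero_dimensional)[U [[oU cU] Ux nUy]].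
exists (U, ~` U); first split => /=.
- exact: open_nbhs_nbhs.
- by apply: open_nbhs_nbhs; split => //; exact: closed_openC.
- by move=> [a b] /= [Ua nUb] ab; apply: nUb; rewrite -ab.
Qed.

Lemma closed_rel_comp (X Y Z : stoneSpace) (R : Rel X Y) (T : Rel Y Z) :
  closed_rel R -> closed_rel T -> closed_rel (rcomp T R).
Proof.
move=> cR cT; rewrite /closed_rel -[X in closed X]setCK; apply: open_closedC.
rewrite openE => -[x z] /= nTR.
have /compact_near_coveringP := @stone_compact Y.
move=> /(_ _ (nbhs (x, z)) (fun p y => ~ (R p.1 y /\ T y p.2)) _) [].
  move=> y _ /=; have [Rxy|nRxy] := pselect (R x y).
    have nTyz : ~ T y z by move=> Tyz; apply: nTR; exists y.
    have : nbhs (y, z) (~` [set p : Y * Z | T p.1 p.2]).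
      by apply: open_nbhs_nbhs; split => //; exact: closed_openC.
    case=> -[A B] /= [nA nB] AB.
    exists (A, [set p : X * Z | B p.2]); first split => //=.
      by exists (setT, B) => /= [|[? ?] []//]; split => //; exact: filterT.
    by move=> [a [b c]] /= [Aa Bc] [_]; apply: (AB (a, c)).
  have : nbhs (x, y) (~` [set p : X * Y | R p.1 p.2]).
    by apply: open_nbhs_nbhs; split => //; exact: closed_openC.
  case=> -[A B] /= [nA nB] AB.
  exists (B, [set p : X * Z | A p.1]); first split => //=.
    by exists (A, setT) => /= [|[? ?] []//]; split => //; exact: filterT.
  by move=> [a [b c]] /= [Aa Bc] [Rba _]; apply: (AB (b, a)).
move=> [A B] /= AB sub; exists (A, B) => // p /sub nRT [y RT].
exact: (nRT y).
Qed.

Definition StoneR : relCat :=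
  @RelCat stoneSpace (fun X => X) (fun X Y => @closed_rel X Y)
    (fun X => @eq X) closed_rel_eq closed_rel_comp
    (fun X Y R _ => rcomp_eqr R) (fun X Y R _ => rcomp_eql R).

(* A boolean algebra is a [ctbDistrLatticeType]; the one-element algebra is
   allowed. *)
Record boolAlg := BoolAlg {
  ba_disp : Order.disp_t;
  ba_sort :> ctbDistrLatticeType ba_disp }.

Definition subordination (A B : boolAlg) (S : Rel A B) : Prop :=
  [/\ S \bot%O \bot%O /\ S \top%O \top%O,
      forall a b c, S a c -> S b c -> S (a `|` b)%O c,
      forall a c d, S a c -> S a d -> S a (c `&` d)%O &
      forall a b c d, (a <= b)%O -> S b c -> (c <= d)%O -> S a d].

Definition le_rel (B : boolAlg) : Rel B B := fun a b => (a <= b)%O.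

Lemma subordination_le (B : boolAlg) : subordination (@le_rel B).
Proof.
rewrite /le_rel; split=> [//|a b c|a c d|a b c d ab bc cd].
- by move=> ac bc; rewrite leUx ac bc.
- by move=> ac ad; rewrite lexI ac ad.
- exact: le_trans (le_trans ab bc) cd.
Qed.

Lemma subordination_comp (A B C : boolAlg) (S : Rel A B) (T : Rel B C) :
  subordination S -> subordination T -> subordination (rcomp T S).
Proof.
move=> [[S0 S1] SU SI Sle] [[T0 T1] TU TI Tle]; split.
- by split; [exists \bot%O|exists \top%O].
- move=> a b c [x [ax xc]] [y [ay yc]]; exists (x `|` y)%O; split.
    by apply: SU; [apply: Sle (lexx _) ax (leUl _ _)|
                   apply: Sle (lexx _) ay (leUr _ _)].
  exact: TU.
- move=> a c d [x [ax xc]] [y [ay yd]]; exists (x `&` y)%O; split.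
    exact: SI.
  by apply: TI; [apply: Tle (leIl _ _) xc (lexx _)|
                 apply: Tle (leIr _ _) yd (lexx _)].
- move=> a b c d ab [x [bx xc]] cd; exists x; split.
    exact: Sle ab bx (lexx _).
  exact: Tle (lexx _) xc cd.
Qed.

Lemma subordination_comp_ler (A B : boolAlg) (S : Rel A B) :
  subordination S -> rcomp S (@le_rel A) = S.
Proof.
move=> [_ _ _ Sle]; apply/funext => a; apply/funext => b; apply/propext.
split=> [[x [ax xb]]|ab]; first exact: Sle ax xb (lexx _).
by exists a; split=> //; exact: lexx.
Qed.

Lemma subordination_comp_lel (A B : boolAlg) (S : Rel A B) :
  subordination S -> rcomp (@le_rel B) S = S.
Proof.
move=> [_ _ _ Sle]; apply/funext => a; apply/funext => b; apply/propext.
split=> [[x [ax xb]]|ab]; first exact: Sle (lexx _) ax xb.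
by exists b; split=> //; exact: lexx.
Qed.

Definition BAS : relCat :=
  @RelCat boolAlg (fun B => B) subordination le_rel subordination_le
    subordination_comp subordination_comp_ler subordination_comp_lel.

(* The join of [S] and [T] in the lattice of subordinations from [A] to [B]
   ordered by inclusion: the intersection of all subordinations containing
   both (see [sub_join_lub]). *)
Definition sub_join (A B : boolAlg) (S T : Rel A B) : Rel A B :=
  fun a b => forall U : Rel A B, subordination U ->
    (forall x y, S x y -> U x y) -> (forall x y, T x y -> U x y) -> U a b.

Lemma sub_join_lub (A B : boolAlg) (S T : Rel A B) :
  [/\ subordination (sub_join S T),
      forall a b, S a b -> sub_join S T a b,
      forall a b, T a b -> sub_join S T a b &
      forall U : Rel A B, subordination U ->
        (forall a b, S a b -> U a b) -> (forall a b, T a b -> U a b) ->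
        forall a b, sub_join S T a b -> U a b].
Proof.
split; [|by move=> a b ab U _ + _; apply|by move=> a b ab U _ _; apply|
  by move=> U sU SU TU a b; apply].
split.
- by split=> U [[U0 U1] _ _ _].
- move=> a b c ac bc U sU SU TU; have [_ UU _ _] := sU.
  by apply: UU; [exact: ac|exact: bc].
- move=> a c d ac ad U sU SU TU; have [_ _ UI _] := sU.
  by apply: UI; [exact: ac|exact: ad].
- move=> a b c d ab bc cd U sU SU TU; have [_ _ _ Ule] := sU.
  by apply: Ule ab _ cd; exact: bc.
Qed.

Section Subbase.
Context (T : topologicalType) (B : set_system T).
Hypothesis openT :
  @open T = [set \bigcup_(A in D) A | D in subset^~ (finI_from B id)].

Lemma subbase_open A : B A -> open A.
Proof.
move=> BA; rewrite openT; exists [set A]; last by rewrite bigcup_set1.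
move=> _ ->; exists [fset A]%fset; first by move=> C /fset1P ->; rewrite inE.
by rewrite set_fset1 bigcap_set1.
Qed.

Lemma subbase_cvg (F : set_system T) (p : T) : Filter F ->
  (forall A, B A -> A p -> F A) -> F --> p.
Proof.
move=> FF FB A; rewrite /= nbhsE => -[C [oC Cp] CA]; apply: filterS CA _.
move: oC Cp; rewrite openT => -[D DB <-] [E DE Ep].
apply: (@filterS _ F _ E); first by move=> x Ex; exists E.
have [J JB JE] := DB _ DE; move: Ep; rewrite -JE => Jp.
by apply: filter_bigI => i iJ; apply: FB; [have := JB _ iJ; rewrite inE|exact: Jp].
Qed.

End Subbase.

Lemma zero_dimensional_hausdorff (T : topologicalType) :
  zero_dimensional T -> hausdorff_space T.
Proof.
move=> zT x y xy; apply: contrapT => /eqP /zT [U [[oU cU] Ux nUy]].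
have nU : nbhs x U by exact: open_nbhs_nbhs.
have nV : nbhs y (~` U) by apply: open_nbhs_nbhs; split=> //; exact: closed_openC.
by have [z []] := xy _ _ nU nV.
Qed.

Record clopens (X : topologicalType) := Clopens {
  clopen_set :> set X;
  clopenP : clopen clopen_set }.

Section ClopenAlgebra.
Context (X : topologicalType).
Implicit Types U V W : clopens X.

HB.instance Definition _ := gen_eqMixin (clopens X).
HB.instance Definition _ := gen_choiceMixin (clopens X).

Lemma clopens_inj U V : U = V :> set X -> U = V.
Proof.
case: U V => [U cU] [V cV] /= UV; case: _ / UV in cV *.
by rewrite (Prop_irrelevance cU cV).
Qed.

Definition clopI U V : clopens X := Clopens (clopenI (clopenP U) (clopenP V)).
Definition clopU U V : clopens X := Clopens (clopenU (clopenP U) (clopenP V)).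
Definition clopC U : clopens X := Clopens (clopenC set0 (clopenP U)).
Definition clop0 : clopens X := Clopens clopen0.
Definition clop1 : clopens X := Clopens clopenT.

Let le_def U V : `[< U `<=` V >] = (clopI U V == U).
Proof.
apply/asboolP/eqP => [|<-]; last by move=> x [].
by move=> /setIidPl UV; apply: clopens_inj.
Qed.
Let clopIC : commutative clopI.
Proof. by move=> U V; apply: clopens_inj; exact: setIC. Qed.
Let clopUC : commutative clopU.
Proof. by move=> U V; apply: clopens_inj; exact: setUC. Qed.
Let clopIA : associative clopI.
Proof. by move=> U V W; apply: clopens_inj; exact: setIA. Qed.
Let clopUA : associative clopU.
Proof. by move=> U V W; apply: clopens_inj; exact: setUA. Qed.
Let clopUKI V U : clopI U (clopU U V) = U.
Proof. by apply: clopens_inj; rewrite /= setUC setKU. Qed.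
Let clopIKU V U : clopU U (clopI U V) = U.
Proof. by apply: clopens_inj; rewrite /= setIC setKI. Qed.
Let clopIUl : left_distributive clopI clopU.
Proof. by move=> U V W; apply: clopens_inj; exact: setIUl. Qed.
Let clopIid : idempotent_op clopI.
Proof. by move=> U; apply: clopens_inj; exact: setIid. Qed.

Fact clopens_display : Order.disp_t. Proof. by []. Qed.

HB.instance Definition _ :=
  Order.isMeetJoinDistrLattice.Build clopens_display (clopens X)
    le_def (fun _ _ => erefl) clopIC clopUC clopIA clopUA clopUKI clopIKU
    clopIUl clopIid.

Let clop0x U : (clop0 <= U)%O.
Proof. by apply/asboolP. Qed.
Let clopx1 U : (U <= clop1)%O.
Proof. by apply/asboolP. Qed.

HB.instance Definition _ := Order.hasBottom.Build clopens_display (clopens X) clop0x.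
HB.instance Definition _ := Order.hasTop.Build clopens_display (clopens X) clopx1.

Let clopUCv U : (U `|` clopC U)%O = \top%O.
Proof. by apply: clopens_inj; exact: setUv. Qed.
Let clopICv U : (U `&` clopC U)%O = \bot%O.
Proof. by apply: clopens_inj; exact: setICr. Qed.

HB.instance Definition _ :=
  Order.TBDistrLattice_hasComplement.Build clopens_display (clopens X)
    clopUCv clopICv.

End ClopenAlgebra.

Definition clop_ob (X : stoneSpace) : boolAlg := BoolAlg (clopens X).

Definition clop_rel (X Y : topologicalType) (R : Rel X Y) :
    Rel (clopens X) (clopens Y) :=
  fun U V => rimage R U `<=` V.

Definition Clop : fdata StoneR BAS :=
  @FData StoneR BAS clop_ob (fun X Y R => clop_rel R).

Definition proper_filter d (B : ctbDistrLatticeType d) (F : set B) : Prop :=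
  [/\ F \top%O, ~ F \bot%O,
      forall a b, F a -> F b -> F (a `&` b)%O &
      forall a b, (a <= b)%O -> F a -> F b].

Definition is_ultrafilter d (B : ctbDistrLatticeType d) (F : set B) : Prop :=
  proper_filter F /\ forall G, proper_filter G -> F `<=` G -> G = F.

Record ultrafilters d (B : ctbDistrLatticeType d) := Ultrafilters {
  uf_set :> set B;
  uf_ultra : is_ultrafilter uf_set }.

Section UltrafilterSpace.
Context d (B : ctbDistrLatticeType d).
Local Notation Uf := (ultrafilters B).

HB.instance Definition _ := gen_eqMixin Uf.
HB.instance Definition _ := gen_choiceMixin Uf.

Definition uf_basic (a : B) : set Uf := [set x | uf_set x a].

HB.instance Definition _ :=
  @isSubBaseTopological.Build Uf (set Uf) (range uf_basic) id.

Lemma ultrafilters_inj (x y : Uf) : x = y :> set B -> x = y.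
Proof.
case: x y => [x Px] [y Py] /= xy; case: _ / xy in Py *.
by rewrite (Prop_irrelevance Px Py).
Qed.

Lemma ultrafilter_complP (F : set B) :
  is_ultrafilter F <-> proper_filter F /\ forall a, F a \/ F (~` a)%O.
Proof.
split=> -[pF Fmax]; split=> //; have [F1 F0 FI Fle] := pF.
  move=> a; apply: contrapT => /not_orP [nFa nFCa].
  apply: nFa; pose G := [set b | exists2 c, F c & (c `&` a <= b)%O].
  have <- : G = F; last by exists \top%O => //; rewrite meet1x.
  apply: Fmax; last by move=> b Fb; exists b => //; exact: leIl.
  split.
  - by exists \top%O => //; exact: lex1.
  - move=> [c Fc]; rewrite lex0 => /eqP ca; apply: nFCa; apply: Fle Fc.
    rewrite -[c]meetx1 -(joinxC a) meetUr ca join0x; exact: leIr.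
  - move=> b b' [c Fc cb] [c' Fc' cb']; exists (c `&` c')%O; first exact: FI.
    rewrite lexI; apply/andP; split.
      by apply: le_trans cb; rewrite leI2// leIl.
    by apply: le_trans cb'; rewrite leI2// leIr.
  - by move=> b b' bb' [c Fc cb]; exists c => //; exact: le_trans bb'.
move=> G [G1 G0 GI Gle] FG; apply/seteqP; split=> // a Ga.
have [//|/FG GCa] := Fmax a; case: G0; rewrite -(meetxC a); exact: GI.
Qed.

Lemma uf_basicC a : uf_basic (~` a)%O = ~` uf_basic a.
Proof.
apply/seteqP; split=> x; rewrite /uf_basic /=;
  have [[_ x0 xI _] xC] := (ultrafilter_complP x).1 (uf_ultra x).
  by move=> xCa xa; apply: x0; rewrite -(meetxC a); exact: xI.
by move=> nxa; case: (xC a).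
Qed.

Lemma uf_basic_clopen a : clopen (uf_basic a).
Proof.
have o b : open (uf_basic b) by apply: (@subbase_open _ (range uf_basic)) => //; exists b.
by split=> //; rewrite -[X in closed X]setCK -uf_basicC; exact: open_closedC.
Qed.

Lemma uf_zero_dimensional : zero_dimensional Uf.
Proof.
move=> x y xy; have [a [xa nya]] : exists a, uf_set x a /\ ~ uf_set y a.
  apply: contrapT => nxy; case/eqP: xy; apply: ultrafilters_inj.
  apply/esym; case: (uf_ultra x) => _; apply; first by case: (uf_ultra y).
  by move=> a xa; apply: contrapT => nya; apply: nxy; exists a.
by exists (uf_basic a); split=> //; exact: uf_basic_clopen.
Qed.

Lemma uf_compact : compact [set: Uf].
Proof.
rewrite compact_ultra => F FU _.
have FF : ProperFilter F by exact: ultra_proper.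
pose x : set B := [set a | F (uf_basic a)].
have ux : is_ultrafilter x.
  apply/ultrafilter_complP; split; last first.
    by move=> a; rewrite /x /= uf_basicC; exact: in_ultra_setVsetC.
  split.
  - apply: filterS filterT => y _; by case: (uf_ultra y) => -[].
  - move=> /filter_ex[y]; by case: (uf_ultra y) => -[].
  - move=> a b xa xb; apply: filterS (filterI xa xb) => y [ya yb].
    by case: (uf_ultra y) => -[_ _ yI _] _; exact: yI.
  - move=> a b ab; apply: filterS => y.
    by case: (uf_ultra y) => -[_ _ _ yle] _; exact: yle.
exists (Ultrafilters ux); split=> //.
by apply: (@subbase_cvg _ (range uf_basic)) => // _ [a _ <-].
Qed.

End UltrafilterSpace.

Definition uf_ob (B : boolAlg) : stoneSpace :=
  @StoneSpace (ultrafilters B) (@uf_compact _ B)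
    (zero_dimensional_hausdorff (@uf_zero_dimensional _ B))
    (@uf_zero_dimensional _ B).

Definition uf_rel (A B : boolAlg) (S : Rel A B) :
    Rel (ultrafilters A) (ultrafilters B) :=
  fun x y => rimage S x `<=` y.

Definition Uf : fdata BAS StoneR :=
  @FData BAS StoneR uf_ob (fun A B S => uf_rel S).

Record closeds (X : topologicalType) := Closeds {
  closed_set :> set X;
  closedsP : closed closed_set }.

Section Vietoris.
Context (X : topologicalType).

HB.instance Definition _ := gen_eqMixin (closeds X).
HB.instance Definition _ := gen_choiceMixin (closeds X).

Definition vbox (U : set X) : set (closeds X) := [set F | closed_set F `<=` U].
Definition vdia (U : set X) : set (closeds X) :=
  [set F | (closed_set F `&` U) !=set0].

Definition vsubbase : set_system (closeds X) :=
  [set A | exists2 U : set X, open U & A = vbox U \/ A = vdia U].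

HB.instance Definition _ :=
  @isSubBaseTopological.Build (closeds X) (set (closeds X)) vsubbase id.

End Vietoris.

Section VietorisStone.
Context (X : stoneSpace).

Lemma closeds_inj (F G : closeds X) : F = G :> set X -> F = G.
Proof.
case: F G => [F cF] [G cG] /= FG; case: _ / FG in cG *.
by rewrite (Prop_irrelevance cF cG).
Qed.

Lemma vdiaC (U : set X) : ~` vdia U = vbox (~` U).
Proof.
apply/seteqP; split=> F; rewrite /vdia /vbox /=.
  by move=> nFU x Fx Ux; apply: nFU; exists x.
by move=> FU [x [/FU]].
Qed.

Lemma vdia_clopen (U : set X) : clopen U -> clopen (vdia U).
Proof.
move=> [oU cU]; split.
  by apply: (@subbase_open _ (@vsubbase X)) => //; exists U => //; right.
rewrite -[X in closed X]setCK; apply: open_closedC; rewrite vdiaC.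
apply: (@subbase_open _ (@vsubbase X)) => //; exists (~` U); last by left.
exact: closed_openC.
Qed.

Lemma vietoris_zero_dimensional : zero_dimensional (closeds X).
Proof.
have sep (F G : closeds X) x : closed_set F x -> ~ closed_set G x ->
    exists2 U, clopen U & F \in vdia U /\ G \notin vdia U.
  move=> Fx nGx.
  have : nbhs x (~` closed_set G).
    by apply: open_nbhs_nbhs; split=> //; exact/closed_openC/closedsP.
  move=> /(zero_dimensional_cvg (@stone_hausdorff X)
            (@stone_zero_dimensional X) (@stone_compact X)).
  move=> [U [Ux cU] UG]; exists U => //; split; rewrite ?inE ?notin_setE.
    by exists x.
  by move=> [y [Gy /UG]].
move=> F G FG.
have [[x [Fx nGx]]|nFG] := pselect (exists x, closed_set F x /\ ~ closed_set G x).
  have [U cU [/set_mem FU]] := sep _ _ _ Fx nGx; rewrite notin_setE => GU.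
  by exists (vdia U); split=> //; exact: vdia_clopen.
have [[x [Gx nFx]]|nGF] := pselect (exists x, closed_set G x /\ ~ closed_set F x).
  have [U cU [/set_mem GU]] := sep _ _ _ Gx nFx; rewrite notin_setE => FU.
  exists (~` vdia U); split=> //.
  by apply: (clopenC set0); exact: vdia_clopen.
case/eqP: FG; apply: closeds_inj; apply/seteqP; split=> x.
  by move=> Fx; apply: contrapT => nGx; apply: nFG; exists x.
by move=> Gx; apply: contrapT => nFx; apply: nGF; exists x.
Qed.

Lemma vietoris_compact : compact [set: closeds X].
Proof.
rewrite compact_ultra => F FU _.
have FF : ProperFilter F by exact: ultra_proper.
pose L := [set x : X | forall U, open U -> U x -> F (vdia U)].
have cL : closed L.
  rewrite -[X in closed X]setCK; apply: open_closedC; rewrite openE => x nLx.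
  have [U [oU [Ux nFU]]] : exists U, open U /\ U x /\ ~ F (vdia U).
    apply: contrapT => nU; apply: nLx => U oU Ux; apply: contrapT => nFU.
    by apply: nU; exists U.
  apply: (@filterS _ _ _ U); last exact: open_nbhs_nbhs.
  by move=> y Uy Ly; apply: nFU; exact: Ly.
exists (Closeds cL); split=> //.
apply: (@subbase_cvg _ (@vsubbase X)) => // A [U oU] [->|->]; last first.
  by move=> [x [Lx Ux]]; exact: Lx.
rewrite /vbox /= => LU.
have cCU : compact (~` U).
  by apply: (subclosed_compact _ (@stone_compact X)) => //; exact: open_closedC.
have sF : Filter (powerset_filter_from F) by exact: powerset_filter_from_filter.
move/compact_near_coveringP : cCU.
move=> /(_ _ _ (fun A x => forall G : closeds X, A G -> ~ closed_set G x) sF).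
case=> [x nUx|D [DF _ [E DE]] sub].
  have nLx : ~ L x by move=> /LU.
  have [V [oV [Vx nFV]]] : exists V, open V /\ V x /\ ~ F (vdia V).
    apply: contrapT => nV; apply: nLx => V oV Vx; apply: contrapT => nFV.
    by apply: nV; exists V.
  have FV : F (~` vdia V) by case: (in_ultra_setVsetC (vdia V) FU).
  exists (V, [set A | A `<=` ~` vdia V]); first split.
  - exact: open_nbhs_nbhs.
  - apply/near_powerset_filter_fromP; first by move=> ? ?; exact: subset_trans.
    by exists (~` vdia V).
  - move=> [y A'] /= [Vy A'V] G A'G Gy.
    by apply: (A'V _ A'G); exists y.
apply: filterS (DF _ DE) => G EG x Gx; apply: contrapT => nUx.
exact: (sub _ DE x nUx G EG Gx).
Qed.

End VietorisStone.

Definition vietoris (X : stoneSpace) : stoneSpace :=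
  @StoneSpace (closeds X) (@vietoris_compact X)
    (zero_dimensional_hausdorff (@vietoris_zero_dimensional X))
    (@vietoris_zero_dimensional X).

Section VietorisRelations.
Context (X Y : topologicalType) (R : Rel X Y).

Definition vbox_rel : Rel (closeds X) (closeds Y) :=
  fun F G => closed_set G `<=` rimage R F.

Definition vdia_rel : Rel (closeds X) (closeds Y) :=
  fun F G => closed_set F `<=` rpreimage R G.

Definition vEM_rel : Rel (closeds X) (closeds Y) :=
  fun F G => vbox_rel F G /\ vdia_rel F G.

End VietorisRelations.

Definition VBox : fdata StoneR StoneR :=
  @FData StoneR StoneR vietoris (fun X Y R => vbox_rel R).
Definition VDia : fdata StoneR StoneR :=
  @FData StoneR StoneR vietoris (fun X Y R => vdia_rel R).
Definition VR : fdata StoneR StoneR :=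
  @FData StoneR StoneR vietoris (fun X Y R => vEM_rel R).

Inductive bterm (X : Type) : Type :=
  | BVar of X
  | BBot
  | BTop
  | BMeet of bterm X & bterm X
  | BJoin of bterm X & bterm X
  | BCompl of bterm X.

Arguments BBot {X}.
Arguments BTop {X}.

(* The least congruence of the term algebra that contains [E] and the axioms
   of boolean algebras: its quotient is the free boolean algebra over [X]
   modulo the equations [E]. *)
Inductive bcong (X : Type) (E : Rel (bterm X) (bterm X)) :
    bterm X -> bterm X -> Prop :=
  | BC_ax s t of E s t : bcong E s t
  | BC_refl s : bcong E s s
  | BC_sym s t of bcong E s t : bcong E t s
  | BC_trans s t u of bcong E s t & bcong E t u : bcong E s u
  | BC_meet s s' t t' of bcong E s s' & bcong E t t' :
      bcong E (BMeet s t) (BMeet s' t')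
  | BC_join s s' t t' of bcong E s s' & bcong E t t' :
      bcong E (BJoin s t) (BJoin s' t')
  | BC_compl s s' of bcong E s s' : bcong E (BCompl s) (BCompl s')
  | BC_meetC s t : bcong E (BMeet s t) (BMeet t s)
  | BC_joinC s t : bcong E (BJoin s t) (BJoin t s)
  | BC_meetA s t u : bcong E (BMeet s (BMeet t u)) (BMeet (BMeet s t) u)
  | BC_joinA s t u : bcong E (BJoin s (BJoin t u)) (BJoin (BJoin s t) u)
  | BC_joinKI s t : bcong E (BMeet s (BJoin s t)) s
  | BC_meetKU s t : bcong E (BJoin s (BMeet s t)) s
  | BC_meetUl s t u :
      bcong E (BMeet (BJoin s t) u) (BJoin (BMeet s u) (BMeet t u))
  | BC_bot s : bcong E (BJoin BBot s) s
  | BC_top s : bcong E (BMeet s BTop) s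
  | BC_joinxC s : bcong E (BJoin s (BCompl s)) BTop
  | BC_meetxC s : bcong E (BMeet s (BCompl s)) BBot.

HB.instance Definition _ (X : Type) := gen_eqMixin (bterm X).
HB.instance Definition _ (X : Type) := gen_choiceMixin (bterm X).

Section Presented.
Context (X : Type) (E : Rel (bterm X) (bterm X)).

Definition bcongb : rel (bterm X) := fun s t => `[< bcong E s t >].

Lemma bcongb_refl : reflexive bcongb.
Proof. by move=> s; apply/asboolP; exact: BC_refl. Qed.
Lemma bcongb_sym : symmetric bcongb.
Proof. by move=> s t; apply/asboolP/asboolP; exact: BC_sym. Qed.
Lemma bcongb_trans : transitive bcongb.
Proof.
by move=> t s u /asboolP st /asboolP tu; apply/asboolP; exact: BC_trans tu.
Qed.

Canonical bcong_equiv := EquivRel bcongb bcongb_refl bcongb_sym bcongb_trans.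

Definition presented := {eq_quot bcong_equiv}%qT.

HB.instance Definition _ := Choice.on presented.

Definition pcls (s : bterm X) : presented := \pi_presented%qT s.

Lemma pcls_eq s t : pcls s = pcls t <-> bcong E s t.
Proof.
split=> [/eqquotP/asboolP//|st].
by apply/eqquotP/asboolP.
Qed.

Definition prepr (x : presented) : bterm X := repr x.

Lemma preprK x : pcls (prepr x) = x.
Proof. exact: reprK. Qed.

Lemma pcls_repr s : bcong E (prepr (pcls s)) s.
Proof. by apply/pcls_eq; rewrite preprK. Qed.

Definition pmeet (x y : presented) := pcls (BMeet (prepr x) (prepr y)).
Definition pjoin (x y : presented) := pcls (BJoin (prepr x) (prepr y)).
Definition pcompl (x : presented) := pcls (BCompl (prepr x)).
Definition pbot := pcls BBot.
Definition ptop := pcls BTop.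

Lemma pmeetE s t : pmeet (pcls s) (pcls t) = pcls (BMeet s t).
Proof. by apply/pcls_eq; apply: BC_meet; exact: pcls_repr. Qed.
Lemma pjoinE s t : pjoin (pcls s) (pcls t) = pcls (BJoin s t).
Proof. by apply/pcls_eq; apply: BC_join; exact: pcls_repr. Qed.
Lemma pcomplE s : pcompl (pcls s) = pcls (BCompl s).
Proof. by apply/pcls_eq; apply: BC_compl; exact: pcls_repr. Qed.

Lemma pcls_ind (P : presented -> Prop) : (forall s, P (pcls s)) -> forall x, P x.
Proof. by move=> Ps x; rewrite -(preprK x). Qed.

Let pmeetC : commutative pmeet.
Proof.
by elim/pcls_ind => s; elim/pcls_ind => t; rewrite !pmeetE; apply/pcls_eq; constructor.
Qed.
Let pjoinC : commutative pjoin.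
Proof.
by elim/pcls_ind => s; elim/pcls_ind => t; rewrite !pjoinE; apply/pcls_eq; constructor.
Qed.
Let pmeetA : associative pmeet.
Proof.
elim/pcls_ind => s; elim/pcls_ind => t; elim/pcls_ind => u.
by rewrite !pmeetE; apply/pcls_eq; exact: BC_meetA.
Qed.
Let pjoinA : associative pjoin.
Proof.
elim/pcls_ind => s; elim/pcls_ind => t; elim/pcls_ind => u.
by rewrite !pjoinE; apply/pcls_eq; exact: BC_joinA.
Qed.
Let pjoinKI y x : pmeet x (pjoin x y) = x.
Proof.
elim/pcls_ind: x => s; elim/pcls_ind: y => t.
by rewrite pjoinE pmeetE; apply/pcls_eq; exact: BC_joinKI.
Qed.
Let pmeetKU y x : pjoin x (pmeet x y) = x.
Proof.
elim/pcls_ind: x => s; elim/pcls_ind: y => t.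
by rewrite pmeetE pjoinE; apply/pcls_eq; exact: BC_meetKU.
Qed.
Let pmeetUl : left_distributive pmeet pjoin.
Proof.
elim/pcls_ind => s; elim/pcls_ind => t; elim/pcls_ind => u.
by rewrite !(pmeetE, pjoinE); apply/pcls_eq; exact: BC_meetUl.
Qed.
Let pmeetxx : idempotent_op pmeet.
Proof. by move=> x; rewrite -{2}[x](pmeetKU x) pjoinKI. Qed.

Fact presented_display : Order.disp_t. Proof. by []. Qed.

HB.instance Definition _ :=
  Order.isMeetJoinDistrLattice.Build presented_display presented
    (fun _ _ => erefl) (fun _ _ => erefl) pmeetC pjoinC pmeetA pjoinA
    pjoinKI pmeetKU pmeetUl pmeetxx.

Let pbot_le x : (pbot <= x)%O.
Proof.
apply/eqP; elim/pcls_ind: x => s; rewrite -[X in pmeet _ X = _](_ : pjoin pbot (pcls s) = _).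
  exact: pjoinKI.
by rewrite pjoinE; apply/pcls_eq; exact: BC_bot.
Qed.
Let ptop_ge x : (x <= ptop)%O.
Proof.
by apply/eqP; elim/pcls_ind: x => s; rewrite [LHS]pmeetE; apply/pcls_eq; exact: BC_top.
Qed.

HB.instance Definition _ := Order.hasBottom.Build presented_display presented pbot_le.
HB.instance Definition _ := Order.hasTop.Build presented_display presented ptop_ge.

Let pjoinxC x : (x `|` pcompl x)%O = \top%O.
Proof.
elim/pcls_ind: x => s; rewrite pcomplE [LHS]pjoinE; apply/pcls_eq.
exact: BC_joinxC.
Qed.
Let pmeetxC x : (x `&` pcompl x)%O = \bot%O.
Proof.
elim/pcls_ind: x => s; rewrite pcomplE [LHS]pmeetE; apply/pcls_eq.
exact: BC_meetxC.
Qed.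

HB.instance Definition _ :=
  Order.TBDistrLattice_hasComplement.Build presented_display presented
    pjoinxC pmeetxC.

End Presented.

Inductive kgen (B : Type) : Type := KBoxGen of B | KDiaGen of B.

Section KAlgebra.
Context (B : boolAlg).

Let box (a : B) : bterm (kgen B) := BVar (KBoxGen a).
Let dia (a : B) : bterm (kgen B) := BVar (KDiaGen a).

(* The inequality [s <= t] is the equation [BMeet s t = s]. *)
Inductive krel : bterm (kgen B) -> bterm (kgen B) -> Prop :=
  | KR_box1 : krel (box \top%O) BTop
  | KR_dia0 : krel (dia \bot%O) BBot
  | KR_boxI a b : krel (box (a `&` b)%O) (BMeet (box a) (box b))
  | KR_diaU a b : krel (dia (a `|` b)%O) (BJoin (dia a) (dia b))
  | KR_boxU a b :
      krel (BMeet (box (a `|` b)%O) (BJoin (box a) (dia b))) (box (a `|` b)%O)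
  | KR_diaI a b :
      krel (BMeet (BMeet (box a) (dia b)) (dia (a `&` b)%O))
           (BMeet (box a) (dia b)).

Definition kalg : boolAlg := BoolAlg (presented krel).

Definition kbox (a : B) : kalg := pcls krel (box a).
Definition kdia (a : B) : kalg := pcls krel (dia a).

(* [s] lists the disjuncts of a disjunctive normal form of [x]: the pair
   [(a, [:: b1; ...; bn])] stands for the meet of [kbox a] and the [kdia bi]. *)
Definition is_dnf (x : kalg) (s : seq (B * seq B)) : Prop :=
  (forall p b, p \in s -> b \in p.2 -> b <> \bot%O /\ (b <= p.1)%O) /\
  x = (\join_(p <- s) (kbox p.1 `&` \meet_(b <- p.2) kdia b))%O.

(* [s] lists the conjuncts of a conjunctive normal form of [x]: the pair
   [(c, [:: d1; ...; dm])] stands for the join of [kdia c] and the [kbox di]. *)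
Definition is_cnf (x : kalg) (s : seq (B * seq B)) : Prop :=
  (forall q d, q \in s -> d \in q.2 -> (q.1 <= d)%O /\ d <> \top%O) /\
  x = (\meet_(q <- s) (kdia q.1 `|` \join_(d <- q.2) kbox d))%O.

End KAlgebra.

Section KRelations.
Context (A B : boolAlg) (S : Rel A B).

Definition kbox_rel : Rel (kalg A) (kalg B) := fun x y =>
  exists s t, [/\ is_dnf x s, is_cnf y t &
    forall p q, p \in s -> q \in t -> exists2 d, d \in q.2 & S p.1 d].

Definition kdia_rel : Rel (kalg A) (kalg B) := fun x y =>
  exists s t, [/\ is_dnf x s, is_cnf y t &
    forall p q, p \in s -> q \in t -> exists2 b, b \in p.2 & S b q.1].

Definition kS_rel : Rel (kalg A) (kalg B) := sub_join kbox_rel kdia_rel.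

End KRelations.

Definition KBox : fdata BAS BAS :=
  @FData BAS BAS kalg (fun A B S => @kbox_rel A B S).
Definition KDia : fdata BAS BAS :=
  @FData BAS BAS kalg (fun A B S => @kdia_rel A B S).
Definition KS : fdata BAS BAS :=
  @FData BAS BAS kalg (fun A B S => @kS_rel A B S).

(* Main.v *)
From mathcomp Require Import all_boot all_order.
From mathcomp Require Import boolp classical_sets filter topology.
Require Import Defs.

(** The theorem follows from Stone duality together with one computation inside
    [kalg B].

    Stone duality for relations says that [Clop] and [Uf] are functors and that
    the identities are naturally isomorphic to [Uf \oF Clop] and [Clop \oF Uf]
    ([id_UfClop], [id_ClopUf]).  The isomorphisms are the classical ones, a point
    going to the ultrafilter of its clopen neighbourhoods and an element to the
    clopen set of the ultrafilters containing it; that they are natural means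
    that a closed relation, or a subordination, is determined by its dual
    ([point_ufP], [uf_relP]).  Both facts are separation statements: disjoint
    closed sets of a Stone space are separated by a clopen set, and a filter and
    a disjoint ideal by an ultrafilter.

    The computation is a natural isomorphism from [K] to [Clop \oF V \oF Uf],
    for [K] and [V] any of the three pairs of constructions.  The generators of
    [kalg B] are interpreted as the clopen sets [vbox] and [vdia] of the Vietoris
    space of [Uf B], which gives a map [kval].  Two inclusions between values
    have to be decided.  Let [x] have disjuncts [box a /\ dia b1 /\ ...] and [y]
    conjuncts [dia c \/ box d1 \/ ...].  Testing the inclusion of [kval x] in
    [kval y] on the closed sets [a /\ ~ c] shows that [x <= y] ([kval_le]).
    For a subordination [S] with dual relation [R], testing on the pair of [a]
    and [R[a] /\ ~ c], respectively of [a /\ R^-1[~ c]] and [~ c], shows that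
    the relations defined through normal forms are exactly the relations
    [clop_rel (vbox_rel R)] and [clop_rel (vdia_rel R)] read through [kval]
    ([kbox_relE], [kdia_relE]); in particular they do not depend on the choice
    of the normal forms.  For the third pair, duality reverses inclusion, so the
    join of two subordinations corresponds to the intersection of the dual
    relations ([sub_join_clop_rel]), and [vEM_rel] is such an intersection.

    The rest is formal.  Semi-functoriality of [K] is inherited from that of [V]
    along the isomorphism, and whiskering it with the two isomorphisms of Stone
    duality gives [Uf \oF K ~=~ V \oF Uf] and [Clop \oF V ~=~ K \oF Clop]. *)

Set Implicit Arguments.
Unset Strict Implicit.
Unset Printing Implicit Defensive.

Import Order.Theory.
Local Open Scope classical_set_scope.

(** * Natural isomorphisms of semi-functors *)

Lemma rcompA A B C D (U : Rel C D) (T : Rel B C) (R : Rel A B) :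
  rcomp U (rcomp T R) = rcomp (rcomp U T) R.
Proof.
apply/funext => a; apply/funext => d; apply/propext; split.
  by move=> [c [[b [ab bc]] cd]]; exists b; split=> //; exists c.
by move=> [b [ab [c [bc cd]]]]; exists c; split=> //; exists b.
Qed.

Lemma eq_rel A B (R T : Rel A B) : (forall a b, R a b <-> T a b) -> R = T.
Proof. by move=> RT; apply/funext => a; apply/funext => b; apply/propext. Qed.

Definition idF (C : relCat) : fdata C C := @FData C C (fun X => X) (fun X Y R => R).

Lemma semifunctor_comp (C D E : relCat) (G : fdata D E) (F : fdata C D) :
  is_semifunctor G -> is_semifunctor F -> is_semifunctor (G \oF F).
Proof.
move=> [Gm Gc] [Fm Fc]; split=> [X Y R mR|X Y Z R T mR mT] /=.
  exact/Gm/Fm.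
by rewrite Fc// Gc//; exact: Fm.
Qed.

Lemma functor_comp (C D E : relCat) (G : fdata D E) (F : fdata C D) :
  is_functor G -> is_functor F -> is_functor (G \oF F).
Proof.
move=> [sG Gi] [sF Fi]; split; first exact: semifunctor_comp.
by move=> X /=; rewrite Fi Gi.
Qed.

Section NatIso.
Context (C D : relCat).
Implicit Types F G H : fdata C D.

Lemma nat_iso_sym F G : F ~=~ G -> G ~=~ F.
Proof. by move=> [a [b [na nb ab ba]]]; exists b, a. Qed.

Lemma is_nat_comp F G H
    (a : forall X, Rel (carrier (F X)) (carrier (G X)))
    (b : forall X, Rel (carrier (G X)) (carrier (H X))) :
  is_nat a -> is_nat b -> is_nat (fun X => rcomp (b X) (a X)).
Proof.
move=> [am an al ar] [bm bn bl br]; split.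
- by move=> X; exact: ismor_comp.
- by move=> X Y R mR; rewrite rcompA bn// -!rcompA an.
- by move=> X; rewrite -rcompA al.
- by move=> X; rewrite rcompA br.
Qed.

Lemma nat_iso_trans G F H : F ~=~ G -> G ~=~ H -> F ~=~ H.
Proof.
move=> [a [b [na nb ab ba]]] [c [d [nc nd cd dc]]].
exists (fun X => rcomp (c X) (a X)), (fun X => rcomp (b X) (d X)); split.
- exact: is_nat_comp.
- exact: is_nat_comp.
- move=> X; rewrite rcompA -(rcompA (c X)) ab -rcompA.
  by case: nd => _ _ _ ->.
- move=> X; rewrite rcompA -(rcompA (b X)) dc -rcompA.
  by case: na => _ _ _ ->.
Qed.

End NatIso.

Lemma is_nat_whiskerl (C D E : relCat) (H : fdata D E) (F G : fdata C D)
    (a : forall X, Rel (carrier (F X)) (carrier (G X))) :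
  is_semifunctor H -> is_semifunctor F -> is_semifunctor G -> is_nat a ->
  @is_nat _ _ (H \oF F) (H \oF G) (fun X => fmor H (a X)).
Proof.
move=> [Hm Hc] [Fm _] [Gm _] [am an al ar]; split=> /=.
- by move=> X; exact: Hm.
- by move=> X Y R mR; rewrite -!Hc ?an//; [exact: Fm|exact: Gm].
- by move=> X; rewrite -Hc ?al//; exact/Fm/ismor_id.
- by move=> X; rewrite -Hc ?ar//; exact/Gm/ismor_id.
Qed.

Lemma nat_iso_whiskerl (C D E : relCat) (H : fdata D E) (F G : fdata C D) :
  is_semifunctor H -> is_semifunctor F -> is_semifunctor G ->
  F ~=~ G -> H \oF F ~=~ H \oF G.
Proof.
move=> sH sF sG [a [b [na nb ab ba]]].
exists (fun X => fmor H (a X)), (fun X => fmor H (b X)).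
have [Hm Hc] := sH; have [am _ _ _] := na; have [bm _ _ _] := nb.
split; [exact: is_nat_whiskerl|exact: is_nat_whiskerl| |].
- by move=> X /=; rewrite -Hc// ab.
- by move=> X /=; rewrite -Hc// ba.
Qed.

(** The component [a (F X)] absorbs the identity of [F X], while naturality asks
    for the absorption of the possibly different morphism [fmor F (idr X)]; hence
    the correction by [fmor G (fmor F (idr X))]. *)
Lemma is_nat_whiskerr (C D E : relCat) (F : fdata C D) (G H : fdata D E)
    (a : forall X, Rel (carrier (G X)) (carrier (H X))) :
  is_semifunctor F -> is_semifunctor G -> is_nat a ->
  @is_nat _ _ (G \oF F) (H \oF F)
    (fun X => rcomp (a (F X)) (fmor G (fmor F (idr X)))).
Proof.
move=> [Fm Fc] [Gm Gc] [am an al ar].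
have mi X : ismor (fmor F (idr X)) by exact/Fm/ismor_id.
have GFl (X Y : C) (R : Rel (carrier X) (carrier Y)) : ismor R ->
    rcomp (fmor G (fmor F (idr Y))) (fmor G (fmor F R)) = fmor G (fmor F R).
  by move=> mR; rewrite -Gc -?Fc ?comp_idl//; [exact: ismor_id|exact: Fm].
have GFr (X Y : C) (R : Rel (carrier X) (carrier Y)) : ismor R ->
    rcomp (fmor G (fmor F R)) (fmor G (fmor F (idr X))) = fmor G (fmor F R).
  by move=> mR; rewrite -Gc -?Fc ?comp_idr//; [exact: ismor_id|exact: Fm].
split=> /=.
- by move=> X; apply: ismor_comp => //; exact: Gm.
- move=> X Y R mR; rewrite rcompA an; last exact: Fm.
  by rewrite -!rcompA GFl// GFr.
- by move=> X; rewrite -rcompA GFr//; exact: ismor_id.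
- by move=> X; rewrite rcompA an// -rcompA GFr//; exact: ismor_id.
Qed.

Lemma nat_iso_whiskerr (C D E : relCat) (F : fdata C D) (G H : fdata D E) :
  is_semifunctor F -> is_semifunctor G -> is_semifunctor H ->
  G ~=~ H -> G \oF F ~=~ H \oF F.
Proof.
move=> sF sG sH [a [b [na nb ab ba]]].
have [Fm Fc] := sF; have [Gm Gc] := sG; have [Hm Hc] := sH.
have [am an al ar] := na; have [bm bn bl br] := nb.
have mi X : ismor (fmor F (idr X)) by exact/Fm/ismor_id.
have Fi X : rcomp (fmor F (idr X)) (fmor F (idr X)) = fmor F (idr X).
  by rewrite -Fc ?comp_idl//; exact: ismor_id.
exists (fun X => rcomp (a (F X)) (fmor G (fmor F (idr X)))),
  (fun X => rcomp (b (F X)) (fmor H (fmor F (idr X)))); split.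
- exact: is_nat_whiskerr.
- exact: is_nat_whiskerr.
- move=> X /=; rewrite -an// -rcompA (rcompA (a _)) ab -!Hc ?comp_idl ?Fi//.
  exact: ismor_id.
- move=> X /=; rewrite -bn// -rcompA (rcompA (b _)) ba -!Gc ?comp_idl ?Fi//.
  exact: ismor_id.
Qed.

(** Families of isomorphisms [k X] of the target category that conjugate the
    action of [G] into that of [F].  Such a family need not be a natural
    transformation of semi-functors, because [k X] does not absorb
    [fmor F (idr X)]; composing it with these idempotents gives one. *)
Section Transport.
Context (C D : relCat) (F G : fdata C D).
Context (k : forall X : C, Rel (carrier (F X)) (carrier (G X))).
Context (k' : forall X : C, Rel (carrier (G X)) (carrier (F X))).
Arguments k : clear implicits.
Arguments k' : clear implicits.
Hypothesis km : forall X, ismor (k X).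
Hypothesis k'm : forall X, ismor (k' X).
Hypothesis kK : forall X, rcomp (k' X) (k X) = idr (F X).
Hypothesis k'K : forall X, rcomp (k X) (k' X) = idr (G X).
Hypothesis FE : forall (X Y : C) (R : Rel (carrier X) (carrier Y)),
  ismor R -> fmor F R = rcomp (k' Y) (rcomp (fmor G R) (k X)).
Hypothesis sG : is_semifunctor G.

Lemma transport_semifunctor : is_semifunctor F.
Proof.
have [Gm Gc] := sG; split=> [X Y R mR|X Y Z R T mR mT].
  rewrite FE//; apply: ismor_comp => //; apply: ismor_comp => //; exact: Gm.
rewrite !FE//; last exact: ismor_comp.
rewrite -!rcompA (rcompA (k Y)) k'K (rcompA (idr _)) comp_idl; last exact: Gm.
by rewrite Gc// -rcompA.
Qed.

Lemma transport_functor : is_functor G -> is_functor F.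
Proof.
move=> [_ Gi]; split; first exact: transport_semifunctor.
by move=> X; rewrite FE ?Gi ?comp_idl//; exact: ismor_id.
Qed.

Lemma transport_nat_iso : F ~=~ G.
Proof.
have [Gm Gc] := sG; have [Fm Fc] := transport_semifunctor.
have kF (X Y : C) (R : Rel (carrier X) (carrier Y)) : ismor R ->
    rcomp (k Y) (fmor F R) = rcomp (fmor G R) (k X).
  move=> mR; rewrite FE// rcompA k'K comp_idl//.
  by apply: ismor_comp => //; exact: Gm.
have Fk' (X Y : C) (R : Rel (carrier X) (carrier Y)) : ismor R ->
    rcomp (fmor F R) (k' X) = rcomp (k' Y) (fmor G R).
  by move=> mR; rewrite FE// -!rcompA k'K comp_idr//; exact: Gm.
have Fl (X Y : C) (R : Rel (carrier X) (carrier Y)) : ismor R ->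
    rcomp (fmor F (idr Y)) (fmor F R) = fmor F R.
  by move=> mR; rewrite -Fc ?comp_idl//; exact: ismor_id.
have Fr (X Y : C) (R : Rel (carrier X) (carrier Y)) : ismor R ->
    rcomp (fmor F R) (fmor F (idr X)) = fmor F R.
  by move=> mR; rewrite -Fc ?comp_idr//; exact: ismor_id.
have Gl (X Y : C) (R : Rel (carrier X) (carrier Y)) : ismor R ->
    rcomp (fmor G (idr Y)) (fmor G R) = fmor G R.
  by move=> mR; rewrite -Gc ?comp_idl//; exact: ismor_id.
have Gr (X Y : C) (R : Rel (carrier X) (carrier Y)) : ismor R ->
    rcomp (fmor G R) (fmor G (idr X)) = fmor G R.
  by move=> mR; rewrite -Gc ?comp_idr//; exact: ismor_id.
have mi (X : C) : ismor (idr X) by exact: ismor_id.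
exists (fun X => rcomp (k X) (fmor F (idr X))),
  (fun X => rcomp (k' X) (fmor G (idr X))); split; first split.
- by move=> X; apply: ismor_comp => //; exact: Fm.
- by move=> X Y R mR; rewrite rcompA -kF// -!rcompA Fl// Fr.
- by move=> X; rewrite -rcompA Fl.
- by move=> X; rewrite rcompA -kF// -rcompA Fl.
- split.
  + by move=> X; apply: ismor_comp => //; exact: Gm.
  + by move=> X Y R mR; rewrite rcompA Fk'// -!rcompA Gl// Gr.
  + by move=> X; rewrite -rcompA Gl.
  + by move=> X; rewrite rcompA Fk'// -rcompA Gl.
- move=> X; rewrite kF// -rcompA (rcompA (k X)) k'K comp_idl ?Gl//; exact: Gm.
- move=> X; rewrite -Fk'// -rcompA (rcompA (k' X)) kK comp_idl ?Fl//; exact: Fm.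
Qed.

End Transport.

(** * Order isomorphisms of boolean algebras as isomorphisms of [BAS] *)

Section OrderIso.
Context (A B : boolAlg) (e : A -> B).

(** Preservation of the operations of the algebras is a consequence. *)
Definition order_iso : Prop :=
  (forall a b, (e a <= e b)%O = (a <= b)%O) /\ (forall c, exists a, e a = c).

Definition iso_rel : Rel A B := fun a c => (e a <= c)%O.
Definition iso_rel_inv : Rel B A := fun c a => (c <= e a)%O.

Hypothesis e_iso : order_iso.
Let eP := e_iso.1.
Let e_surj := e_iso.2.

Lemma iso_rel_sub : subordination iso_rel.
Proof.
rewrite /iso_rel; split.
- split; last exact: lex1.
  by have [z <-] := e_surj (\bot : B)%O; rewrite eP le0x.
- move=> a b c; have [z <-] := e_surj c.
  by rewrite !eP => az bz; rewrite leUx az.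
- by move=> a c d ac ad; rewrite lexI ac.
- by move=> a b c d ab bc cd; apply: le_trans cd; apply: le_trans bc; rewrite eP.
Qed.

Lemma iso_rel_inv_sub : subordination iso_rel_inv.
Proof.
rewrite /iso_rel_inv; split.
- split; first exact: le0x.
  by have [z <-] := e_surj (\top : B)%O; rewrite eP lex1.
- by move=> c d a ca da; rewrite leUx ca.
- move=> c a b; have [z <-] := e_surj c.
  by rewrite !eP => za zb; rewrite lexI za.
- move=> a b c d ab bc cd; apply: le_trans ab _; apply: le_trans bc _.
  by rewrite eP.
Qed.

Lemma iso_relK : rcomp iso_rel_inv iso_rel = @le_rel A.
Proof.
apply: eq_rel => a b; split; last first.
  by move=> ab; exists (e a); split; [exact: lexx|rewrite /iso_rel_inv eP].
by move=> [c [ac cb]]; rewrite /le_rel -eP; exact: le_trans cb.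
Qed.

Lemma iso_rel_invK : rcomp iso_rel iso_rel_inv = @le_rel B.
Proof.
apply: eq_rel => c d; split; first by move=> [a [ca ad]]; exact: le_trans ad.
move=> cd; have [a ad] := e_surj d; exists a.
by rewrite /iso_rel /iso_rel_inv ad; split=> //; exact: lexx.
Qed.

End OrderIso.

Definition pull_rel (A A' B B' : boolAlg) (e : A -> A') (f : B -> B')
  (S : Rel A' B') : Rel A B := fun a b => S (e a) (f b).

Section Pull.
Context (A A' B B' : boolAlg) (e : A -> A') (f : B -> B').
Hypotheses (e_iso : order_iso e) (f_iso : order_iso f).

(** Pulling back is conjugation by isomorphisms of [BAS]; this gives
    [pull_rel_sub] and the compatibility of pulling back with joins. *)
Lemma pull_relE (S : Rel A' B') : subordination S ->
  pull_rel e f S = rcomp (iso_rel_inv f) (rcomp S (iso_rel e)).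
Proof.
move=> [_ _ _ Sle]; apply: eq_rel => a b.
split=> [ab|[d [[c [ac cd]] db]]]; last exact: Sle ac cd db.
by exists (f b); split; [exists (e a); split=> //|]; exact: lexx.
Qed.

Lemma pull_rel_sub (S : Rel A' B') :
  subordination S -> subordination (pull_rel e f S).
Proof.
move=> sS; rewrite pull_relE//.
apply: subordination_comp; last exact: iso_rel_inv_sub.
by apply: subordination_comp => //; exact: iso_rel_sub.
Qed.

(** A subordination that contains both pulled back relations is pushed forward
    to one that contains [S] and [T], hence their join. *)
Lemma sub_join_pull (S T : Rel A' B') :
  sub_join (pull_rel e f S) (pull_rel e f T) = pull_rel e f (sub_join S T).
Proof.
have [sJ JS JT _] := sub_join_lub S T.
apply: eq_rel => a b; split.
  by apply; [exact: pull_rel_sub|move=> ? ?; exact: JS|move=> ? ?; exact: JT].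
move=> ab U sU SU TU; have [_ _ _ Ule] := sU.
have := ab (rcomp (iso_rel f) (rcomp U (iso_rel_inv e))).
case=> [|c d cd|c d cd|d [[c [ac cd]] db]].
- apply: subordination_comp; last exact: iso_rel_sub.
  by apply: subordination_comp => //; exact: iso_rel_inv_sub.
- have [a' a'c] := e_iso.2 c; have [b' b'd] := f_iso.2 d.
  exists b'; split; last by rewrite /iso_rel b'd lexx.
  exists a'; split; first by rewrite /iso_rel_inv a'c lexx.
  by apply: SU; rewrite /pull_rel a'c b'd.
- have [a' a'c] := e_iso.2 c; have [b' b'd] := f_iso.2 d.
  exists b'; split; last by rewrite /iso_rel b'd lexx.
  exists a'; split; first by rewrite /iso_rel_inv a'c lexx.
  by apply: TU; rewrite /pull_rel a'c b'd.
- by apply: Ule cd _; [rewrite -e_iso.1|rewrite -f_iso.1].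
Qed.

End Pull.

(** The case of the transport lemmas where the conjugating morphisms come from order
    isomorphisms of boolean algebras. *)
Section OrderTransport.
Context (C : relCat) (F G : fdata C BAS) (e : forall X : C, F X -> G X).
Arguments e : clear implicits.
Hypothesis e_iso : forall X, order_iso (e X).
Hypothesis FE : forall (X Y : C) (R : Rel (carrier X) (carrier Y)), ismor R ->
  fmor F R = pull_rel (e X) (e Y) (fmor G R).
Hypothesis sG : is_semifunctor G.

Let k (X : C) : Rel (F X) (G X) := iso_rel (e X).
Let k' (X : C) : Rel (G X) (F X) := iso_rel_inv (e X).
Let km X : subordination (@k X). Proof. exact: iso_rel_sub. Qed.
Let k'm X : subordination (@k' X). Proof. exact: iso_rel_inv_sub. Qed.
Let kK X : rcomp (@k' X) (@k X) = @le_rel (F X). Proof. exact: iso_relK. Qed.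
Let k'K X : rcomp (@k X) (@k' X) = @le_rel (G X). Proof. exact: iso_rel_invK. Qed.

Let Ek (X Y : C) (R : Rel (carrier X) (carrier Y)) : ismor R ->
  fmor F R = rcomp (@k' Y) (rcomp (fmor G R) (@k X)).
Proof. by move=> mR; rewrite FE// pull_relE//; exact: sG.1. Qed.

Lemma order_transport_semifunctor : is_semifunctor F.
Proof. exact: (@transport_semifunctor C BAS F G k k' km k'm k'K Ek sG). Qed.

Lemma order_transport_functor : is_functor G -> is_functor F.
Proof. exact: (@transport_functor C BAS F G k k' km k'm kK k'K Ek sG). Qed.

Lemma order_transport_nat_iso : F ~=~ G.
Proof. exact: (@transport_nat_iso C BAS F G k k' km k'm kK k'K Ek sG). Qed.

End OrderTransport.

(** * Separation in boolean algebras and in Stone spaces *)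

(** The prime filter theorem.  The filter generated by [F] and by the complements
    of the elements of [I] is proper because [F] and [I] are disjoint, and Zorn's
    lemma enlarges it to an ultrafilter. *)
Lemma ultrafilter_separation d (B : ctbDistrLatticeType d) (F I : set B) :
  F \top%O -> (forall a b, F a -> F b -> F (a `&` b)%O) ->
  I \bot%O -> (forall a b, I a -> I b -> I (a `|` b)%O) ->
  (forall a b, F a -> I b -> ~ (a <= b)%O) ->
  exists x : ultrafilters B, F `<=` uf_set x /\ forall b, I b -> ~ uf_set x b.
Proof.
move=> F1 FI I0 IU FIdisj.
pose G0 := [set b : B | exists f i, [/\ F f, I i & (f <= b `|` i)%O]].
have pG0 : proper_filter G0.
  split.
  - by exists \top%O, \bot%O; split=> //; rewrite joinx0.
  - by move=> [f [i [Ff Ii]]]; rewrite join0x; exact: FIdisj.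
  - move=> a b [f [i [Ff Ii fi]]] [g [j [Fg Ij gj]]].
    exists (f `&` g)%O, (i `|` j)%O; split; [exact: FI|exact: IU|].
    rewrite joinIl lexI; apply/andP; split.
      by apply: le_trans (leIl _ _) _; apply: le_trans fi _; rewrite leU2// leUl.
    by apply: le_trans (leIr _ _) _; apply: le_trans gj _; rewrite leU2// leUr.
  - move=> a b ab [f [i [Ff Ii fi]]]; exists f, i; split=> //.
    by apply: le_trans fi _; rewrite leU2.
(* The empty set is allowed because it is the union of the empty chain. *)
pose P (G : set B) := G = set0 \/ (proper_filter G /\ G0 `<=` G).
have chainP (C : set (set B)) : C `<=` P -> total_on C subset ->
    P (\bigcup_(G in C) G).
  move=> CP Ctot; have [C0|] := pselect (forall G, C G -> G = set0).
    by left; rewrite -subset0 => b [G /C0 ->].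
  move/existsNP => [G1 /not_implyP[CG1 G1n0]]; right.
  have CG G b : C G -> G b -> proper_filter G /\ G0 `<=` G.
    by move=> CG Gb; case: (CP _ CG) => [G00|//]; move: Gb; rewrite G00.
  have [//|[[G1T _ _ _] G01]] := CP _ CG1.
  split; last by move=> b /G01 ?; exists G1.
  split.
  - by exists G1.
  - by move=> [G CGG Gb]; case: (CG _ _ CGG Gb) => -[].
  - move=> a b [G CGG Ga] [H CH Hb].
    have [GH|HG] := Ctot _ _ CGG CH.
      have [[_ _ HI _] _] := CG _ _ CH Hb; exists H => //; apply: HI => //.
      exact: GH.
    have [[_ _ GI _] _] := CG _ _ CGG Ga; exists G => //; apply: GI => //.
    exact: HG.
  - move=> a b ab [G CGG Ga]; exists G => //.
    by have [[_ _ _ Gle] _] := CG _ _ CGG Ga; exact: Gle Ga.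
have [A [PA Amax]] := Zorn_bigcup chainP.
have [pA G0A] : proper_filter A /\ G0 `<=` A.
  case: PA => // A0; case: (Amax G0); last by right; split.
  rewrite A0; split; first exact: sub0set.
  by case: pG0 => G01 _ _ _ /(_ _ G01).
have uA : is_ultrafilter A.
  split=> // G pG AG; apply/seteqP; split=> //; apply: contrapT => nGA.
  apply: (Amax G); first by split.
  by right; split=> //; exact: subset_trans AG.
exists (Ultrafilters uA); split=> /=.
  by move=> f Ff; apply: G0A; exists f, \bot%O; rewrite joinx0.
move=> i Ii Ai; have [A1 A0 AI Ale] := pA; apply: A0; rewrite -(meetxC i).
by apply: AI => //; apply: G0A; exists \top%O, i; rewrite joinC joinxC.
Qed.

(** Compactness in the form of an induction principle: a property of sets that
    is stable under finite unions and holds locally holds on a set covering [C]. *)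
Lemma compact_induction (X : topologicalType) (C : set X) (P : set X -> Prop) :
  compact C -> P set0 -> (forall U V, P U -> P V -> P (U `|` V)) ->
  (forall x, C x -> exists U, [/\ open U, U x & P U]) ->
  exists2 U, P U & C `<=` U.
Proof.
move=> /compact_near_coveringP cC P0 PU Cx.
(* Along the filter of the sets containing a given set in [P], every point of
   [C] eventually belongs; compactness makes this uniform over [C]. *)
pose F := filter_from P (fun U => [set V | U `<=` V]).
have FF : Filter F.
  apply: filter_from_filter; first by exists set0.
  move=> U V PU' PV; exists (U `|` V); first exact: PU.
  by move=> W; rewrite /= subUset.
have [x Cx'|U PU' UC] := cC _ F (fun V x => V x) FF.
  have [U [oU Ux PU']] := Cx _ Cx'.
  exists (U, [set V | U `<=` V]); first split.
  - exact: open_nbhs_nbhs.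
  - by exists U.
  - by move=> [y V] /= [Uy]; exact.
by exists U => //; exact: UC.
Qed.

Section Stone.
Context (X : stoneSpace).

Lemma stone_clopen_nbhs (x : X) (U : set X) : open U -> U x ->
  exists V : clopens X, clopen_set V x /\ V `<=` U.
Proof.
move=> oU Ux; have : nbhs x U by exact: open_nbhs_nbhs.
move=> /(zero_dimensional_cvg (@stone_hausdorff X)
            (@stone_zero_dimensional X) (@stone_compact X)) [V [Vx cV] VU].
by exists (Clopens cV).
Qed.

Lemma stone_closed_compact (C : set X) : closed C -> compact C.
Proof. by move=> cC; exact: subclosed_compact cC (@stone_compact X) _. Qed.

Lemma stone_separation (C D : set X) : closed C -> closed D ->
  C `&` D = set0 -> exists U : clopens X, C `<=` U /\ U `&` D = set0.
Proof.
move=> cC cD CD.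
have [||||U [V -> VD] CU] := @compact_induction X C
  (fun U => exists2 V : clopens X, U = V & V `&` D = set0).
- exact: stone_closed_compact.
- by exists (clop0 X) => //; exact: set0I.
- move=> _ _ [U -> UD] [V -> VD]; exists (clopU U V) => //=.
  by rewrite setIUl UD VD setU0.
- move=> x Cx; have [|V [Vx VD]] := @stone_clopen_nbhs x _ (closed_openC cD).
    by move=> Dx; have : (C `&` D) x by []; rewrite CD.
  exists V; split=> //; first by case: (clopenP V).
  by exists V => //; rewrite -subset0 => y [/VD].
by exists V.
Qed.

Lemma stone_separation_point (C : set X) (y : X) : closed C -> ~ C y ->
  exists U : clopens X, C `<=` U /\ ~ clopen_set U y.
Proof.
move=> cC nCy; have [|V [Vy VC]] := @stone_clopen_nbhs y _ (closed_openC cC) => //.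
by exists (clopC V); split=> [x Cx Vx|]; [exact: VC Cx|exact].
Qed.

(** A boolean algebra of clopen sets that separates the points of a compact
    space contains all clopen sets: compactness of the complement of [U] gives
    for every point of [U] an element containing it inside [U], and compactness
    of [U] then gives [U] itself. *)
Lemma clopen_surj d (B : ctbDistrLatticeType d) (f : B -> clopens X) :
  f \bot%O = \bot%O -> (forall a b, f (a `|` b)%O = (f a `|` f b)%O) ->
  (forall a, f (~` a)%O = (~` f a)%O) ->
  (forall x y, x != y -> exists a, clopen_set (f a) x /\ ~ clopen_set (f a) y) ->
  forall U, exists a, f a = U.
Proof.
move=> f0 fU fC fsep U; have [oU cU] := clopenP U.
have fI a b : f (a `&` b)%O = (f a `&` f b)%O.
  by rewrite -[LHS]complK -fC complI fU !fC complU !complK.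
have sep x : clopen_set U x -> exists a, clopen_set (f a) x /\ f a `<=` U.
  move=> Ux; have [||||V [a VE nax] UV] := @compact_induction X (~` U)
    (fun V => exists2 a, V = f a & ~ clopen_set (f a) x).
  - exact/stone_closed_compact/open_closedC.
  - by exists \bot%O; rewrite f0.
  - move=> _ _ [a -> na] [b -> nb]; exists (a `|` b)%O; rewrite fU//=.
    by case.
  - move=> y nUy; have /fsep [a [ay nax]] : y != x.
      by apply/eqP => yx; apply: nUy; rewrite yx.
    exists (f a); split=> //; last by exists a.
    by case: (clopenP (f a)).
  exists (~` a)%O; rewrite fC; split=> // y /= nay; apply: contrapT => nUy.
  by apply: nay; rewrite -VE; exact: UV.
have [||||V [a VE aU] UV] := @compact_induction X U
  (fun V => exists2 a, V = f a & f a `<=` U).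
- exact: stone_closed_compact.
- by exists \bot%O; rewrite f0//; exact: sub0set.
- move=> _ _ [a -> aU] [b -> bU]; exists (a `|` b)%O; rewrite fU//=.
  by rewrite subUset.
- move=> x /sep [a [ax aU]]; exists (f a); split=> //; last by exists a.
  by case: (clopenP (f a)).
by exists a; apply: clopens_inj; apply/seteqP; rewrite -{2}VE.
Qed.

End Stone.

Section ClosedRelations.
Context (X Y : stoneSpace).

Lemma closed_relP (R : Rel X Y) :
  closed_rel R <-> forall x y, ~ R x y -> exists U V, [/\ open U, open V, U x, V y &
    forall x' y', U x' -> V y' -> ~ R x' y'].
Proof.
split=> [cR x y nR|RP].
  have : nbhs (x, y) (~` [set p : X * Y | R p.1 p.2]).
    by apply: open_nbhs_nbhs; split=> //; exact: closed_openC.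
  move=> [[A B] /= [nA nB] AB].
  move: nA nB; rewrite !nbhsE => -[U [oU Ux] UA] [V [oV Vy] VB].
  exists U, V; split=> // x' y' Ux' Vy' /=.
  by apply: (AB (x', y')); split; [exact: UA|exact: VB].
rewrite /closed_rel -[X in closed X]setCK; apply: open_closedC.
rewrite openE => -[x y] /= /RP [U [V [oU oV Ux Vy UV]]].
exists (U, V); first by split; exact: open_nbhs_nbhs.
by move=> [x' y'] [] /=; exact: UV.
Qed.

End ClosedRelations.

Definition rconv A B (R : Rel A B) : Rel B A := fun b a => R a b.

Lemma closed_rel_conv (X Y : stoneSpace) (R : Rel X Y) :
  closed_rel R -> closed_rel (rconv R).
Proof.
move=> /closed_relP RP; apply/closed_relP => y x /RP [U [V [oU oV Ux Vy UV]]].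
by exists V, U; split=> // y' x' Vy' Ux'; exact: UV.
Qed.

(** The tube lemma: if [y] is not related to any point of the compact set [F],
    a neighbourhood of [y] avoids the whole image of [F]. *)
Lemma closed_rimage (X Y : stoneSpace) (R : Rel X Y) (F : set X) :
  closed_rel R -> closed F -> closed (rimage R F).
Proof.
move=> /closed_relP RP cF; rewrite -[X in closed X]setCK; apply: open_closedC.
rewrite openE => y /= nRFy.
have [||||U [V [oV Vy UV]] FU] := @compact_induction X F
  (fun U => exists V, [/\ open V, V y & forall x' y', U x' -> V y' -> ~ R x' y']).
- exact: stone_closed_compact.
- by exists setT; split=> //; exact: openT.
- move=> U U' [V [oV Vy UV]] [V' [oV' Vy' UV']]; exists (V `&` V'); split=> //.
    exact: openI.
  by move=> x' y' [Ux'|Ux'] [Vy1 Vy2]; [exact: UV|exact: UV'].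
- move=> x Fx; have [|U [V [oU oV Ux Vy UV]]] := RP x y.
    by move=> Rxy; apply: nRFy; exists x.
  by exists U; split=> //; exists V.
apply: (@filterS _ _ _ V); last exact: open_nbhs_nbhs.
by move=> y' Vy' [x' Fx']; apply: UV => //; exact: FU.
Qed.

Lemma closed_rpreimage (X Y : stoneSpace) (R : Rel X Y) (G : set Y) :
  closed_rel R -> closed G -> closed (rpreimage R G).
Proof. by move=> /closed_rel_conv; exact: closed_rimage. Qed.

(** * Stone duality for subordinations *)

Section Ultrafilters.
Context d (B : ctbDistrLatticeType d).
Implicit Types (x y : ultrafilters B) (a b : B).

Lemma uf_top x : uf_set x \top%O.
Proof. by case: (uf_ultra x) => -[]. Qed.

Lemma uf_bot x : ~ uf_set x \bot%O.
Proof. by case: (uf_ultra x) => -[]. Qed.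

Lemma uf_meet x a b : uf_set x a -> uf_set x b -> uf_set x (a `&` b)%O.
Proof. by case: (uf_ultra x) => -[_ _ xI _] _; exact: xI. Qed.

Lemma uf_le x a b : (a <= b)%O -> uf_set x a -> uf_set x b.
Proof. by case: (uf_ultra x) => -[_ _ _ xle] _; exact: xle. Qed.

Lemma uf_compl x a : uf_set x (~` a)%O <-> ~ uf_set x a.
Proof.
by have /seteqP [h1 h2] := uf_basicC a; split; [exact: (h1 x)|exact: (h2 x)].
Qed.

Lemma uf_join x a b : uf_set x (a `|` b)%O <-> uf_set x a \/ uf_set x b.
Proof.
split; last by case; apply: uf_le; rewrite ?leUl ?leUr.
move=> xab; apply: contrapT => /not_orP [/uf_compl xa /uf_compl xb].
by have := uf_meet xa xb; rewrite -complU => /uf_compl.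
Qed.

Lemma uf_sub_eq x y : uf_set x `<=` uf_set y -> x = y.
Proof.
move=> xy; apply: ultrafilters_inj; apply/esym.
by case: (uf_ultra x) => _; apply => //; case: (uf_ultra y).
Qed.

Lemma uf_le_separation a b : ~ (a <= b)%O -> exists x, uf_set x a /\ ~ uf_set x b.
Proof.
move=> nab; have [|||||x [xa xb]] := @ultrafilter_separation _ B
  [set c | a <= c]%O [set c | c <= b]%O.
- exact: lex1.
- by move=> c c' /= ac ac'; rewrite lexI ac.
- exact: le0x.
- by move=> c c' /= ac ac'; rewrite leUx ac.
- by move=> c c' /= ac c'b cc'; apply: nab; exact: le_trans (le_trans ac cc') c'b.
- by exists x; split; [apply: xa => /=; exact: lexx|apply: xb => /=; exact: lexx].
Qed.

End Ultrafilters.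

Section UfRel.
Context (A B : boolAlg).

(** The successors of [x] are the ultrafilters containing the filter [S[x]]. *)
Lemma uf_rel_extend (S : Rel A B) (x : ultrafilters A) (I : set B) :
  subordination S -> I \bot%O -> (forall a b, I a -> I b -> I (a `|` b)%O) ->
  (forall a b c, uf_set x a -> S a b -> I c -> ~ (b <= c)%O) ->
  exists y : ultrafilters B, uf_rel S x y /\ forall b, I b -> ~ uf_set y b.
Proof.
move=> [[S0 S1] SU SI Sle] I0 IU xSI.
apply: (ultrafilter_separation (F := rimage S x)) => //.
- by exists \top%O => //; exact: uf_top.
- move=> c d [a xa ac] [b xb bd]; exists (a `&` b)%O; first exact: uf_meet.
  by apply: SI; [apply: Sle (leIl _ _) ac (lexx _)|apply: Sle (leIr _ _) bd (lexx _)].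
- by move=> b c [a xa ab] Ic; exact: (xSI _ _ _ xa ab Ic).
Qed.

(** The predecessors of [y] are the ultrafilters avoiding the ideal of the
    elements related to some element outside [y]. *)
Lemma uf_rel_coextend (S : Rel A B) (a : A) (y : ultrafilters B) :
  subordination S -> rimage S [set a] `<=` uf_set y ->
  exists x : ultrafilters A, uf_set x a /\ uf_rel S x y.
Proof.
move=> [[S0 S1] SU SI Sle] Say.
have [|||||x [xa xI]] := @ultrafilter_separation _ A [set b | a <= b]%O
  (rpreimage S (~` uf_set y)).
- exact: lex1.
- by move=> c c' /= ac ac'; rewrite lexI ac.
- by exists \bot%O => //; exact: uf_bot.
- move=> b b' [c yc bc] [c' yc' bc']; exists (c `|` c')%O.
    by move/uf_join => -[].
  by apply: SU; [apply: Sle (lexx _) bc (leUl _ _)|apply: Sle (lexx _) bc' (leUr _ _)].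
- move=> b b' /= ab [c yc b'c] bb'; apply/yc/Say; exists a => //.
  by apply: Sle b'c (lexx _); exact: le_trans bb'.
exists x; split; first by apply: xa => /=; exact: lexx.
move=> c [b xb bc]; apply: contrapT => nyc; apply: (xI b) => //.
by exists c.
Qed.

(** First separate the filter [S[a]] from the ideal below [b] to get [y], then
    find [x] containing [a] among the predecessors of [y]. *)
Lemma uf_rel_separation (S : Rel A B) a b : subordination S -> ~ S a b ->
  exists x y, [/\ uf_rel S x y, uf_set x a & ~ uf_set y b].
Proof.
move=> sS nSab; have [_ _ _ Sle] := sS.
suff [y [Say nyb]] : exists y : ultrafilters B,
    rimage S [set a] `<=` uf_set y /\ ~ uf_set y b.
  by have [x [xa xy]] := uf_rel_coextend sS Say; exists x, y.
have [[S0 S1] SU SI _] := sS.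
have [|||||y [yF yI]] := @ultrafilter_separation _ B (rimage S [set a]) [set c | c <= b]%O.
- by exists a => //; exact: Sle (lex1 _) S1 (lexx _).
- by move=> c d [_ -> ac] [_ -> ad]; exists a => //; exact: SI.
- exact: le0x.
- by move=> c c' /= ac ac'; rewrite leUx ac.
- move=> c c' [_ -> ac] /= c'b cc'; apply: nSab; apply: Sle (lexx _) ac _.
  exact: le_trans c'b.
- by exists y; split=> //; apply: yI => /=; exact: lexx.
Qed.

Lemma uf_relP (S : Rel A B) a b : subordination S ->
  S a b <-> forall x y, uf_rel S x y -> uf_set x a -> uf_set y b.
Proof.
move=> sS; split=> [Sab x y xy xa|H]; first by apply: xy; exists a.
apply: contrapT => /(uf_rel_separation sS) [x [y [xy xa nyb]]].
exact/nyb/(H x).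
Qed.

Lemma closed_uf_rel (S : Rel A B) :
  @closed_rel (uf_ob A) (uf_ob B) (uf_rel S).
Proof.
apply/closed_relP => x y /existsNP [b /not_implyP [[a xa ab] nyb]].
have [oa _] := uf_basic_clopen a; have [ob _] := uf_basic_clopen (~` b)%O.
exists (uf_basic a), (uf_basic (~` b)%O); split=> //; first exact/uf_compl.
by move=> x' y' x'a /uf_compl y'b xy; apply/y'b/xy; exists a.
Qed.

End UfRel.

Lemma uf_rel_le (B : boolAlg) : uf_rel (@le_rel B) = eq.
Proof.
apply: eq_rel => x y; split=> [xy|-> b [a ya ab]]; last exact: uf_le ya.
by apply: uf_sub_eq => a xa; apply: xy; exists a => //; exact: lexx.
Qed.

(** An intermediate ultrafilter must contain [S[x]] and avoid the elements that
    [T] relates to an element outside [z]; the filter and the ideal are disjoint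
    because [z] contains everything that [rcomp T S] relates to [x]. *)
Lemma uf_rel_comp (A B C : boolAlg) (S : Rel A B) (T : Rel B C) :
  subordination S -> subordination T ->
  uf_rel (rcomp T S) = rcomp (uf_rel T) (uf_rel S).
Proof.
move=> sS sT; have [[T0 T1] TU TI Tle] := sT.
apply: eq_rel => x z; split; last first.
  move=> [y [xy yz]] c [a xa [b [ab bc]]]; apply: yz; exists b => //.
  by apply: xy; exists a.
move=> xz; have [|||y [xy yI]] := uf_rel_extend (x := x)
  (I := rpreimage T (~` uf_set z)) sS.
- by exists \bot%O => //; exact: uf_bot.
- move=> b b' [c zc bc] [c' zc' bc']; exists (c `|` c')%O.
    by move/uf_join => -[].
  by apply: TU; [apply: Tle (lexx _) bc (leUl _ _)|apply: Tle (lexx _) bc' (leUr _ _)].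
- move=> a b b' xa ab [c zc b'c] bb'; apply/zc/xz; exists a => //.
  by exists b; split=> //; exact: Tle b'c (lexx _).
exists y; split=> // c [b yb bc]; apply: contrapT => nzc; apply: (yI b) => //.
by exists c.
Qed.

Lemma Uf_functor : is_functor Uf.
Proof.
split; last by move=> B; exact: uf_rel_le.
split; first by move=> A B S _; exact: closed_uf_rel.
by move=> A B C S T; exact: uf_rel_comp.
Qed.

(** * Stone duality for closed relations *)

Lemma clops_leP (X : topologicalType) (U V : clopens X) : (U <= V)%O <-> U `<=` V.
Proof. by split=> /asboolP. Qed.

Lemma clop_rel_subordination (X Y : stoneSpace) (R : Rel X Y) :
  @subordination (clop_ob X) (clop_ob Y) (clop_rel R).
Proof.
split.
- by split; [move=> y []|].
- by move=> U U' V UV U'V y [x [Ux|Ux] xy]; [apply: UV|apply: U'V]; exists x.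
- by move=> U V V' UV UV' y xy; split; [exact: UV|exact: UV'].
- move=> U U' V V' /clops_leP UU' U'V /clops_leP VV' y [x Ux xy].
  by apply/VV'/U'V; exists x => //; exact: UU'.
Qed.

(** An intermediate clopen set separates the closed sets [R[U]] and
    [T^-1[~ W]]. *)
Lemma Clop_functor : is_functor Clop.
Proof.
split; last first.
  move=> X; apply: eq_rel => U V; split.
    by move=> UV; apply/clops_leP => x Ux; apply: UV; exists x.
  by move=> /clops_leP UV y [x /UV Vx <-].
split; first by move=> X Y R _; exact: clop_rel_subordination.
move=> X Y Z R T cR cT; apply: eq_rel => U W; split; last first.
  move=> [V [UV VW]] z [x Ux [y [xy yz]]]; apply: VW; exists y => //.
  by apply: UV; exists x.
move=> UW; have [_ cU] := clopenP U; have [oW _] := clopenP W.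
have [|||V [RV VT]] := @stone_separation Y (rimage R U) (rpreimage T (~` W)).
- exact: closed_rimage.
- by apply: closed_rpreimage => //; exact: open_closedC.
- rewrite -subset0 => y [[x Ux xy] [z Wz yz]]; apply/Wz/UW; exists x => //.
  by exists y.
exists V; split=> // z [y Vy yz]; apply: contrapT => nWz.
by have : (V `&` rpreimage T (~` W)) y; [split=> //; exists z|rewrite VT].
Qed.

Definition uf_clop (B : boolAlg) (b : B) : clopens (uf_ob B) :=
  Clopens (uf_basic_clopen b).

Lemma uf_clop_le (B : boolAlg) (a b : B) : (uf_clop a <= uf_clop b)%O = (a <= b)%O.
Proof.
apply/idP/idP => [/clops_leP ab|ab]; last by apply/clops_leP => x; exact: uf_le.
apply: contrapT => /uf_le_separation [x [xa nxb]].
exact/nxb/(ab x).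
Qed.

Lemma uf_clop_surj (B : boolAlg) (U : clopens (uf_ob B)) : exists b, uf_clop b = U.
Proof.
apply: (@clopen_surj (uf_ob B) _ B (@uf_clop B)).
- by apply: clopens_inj; apply/seteqP; split=> x //= /uf_bot.
- by move=> a b; apply: clopens_inj; apply/seteqP; split=> x /uf_join.
- by move=> a; apply: clopens_inj; exact: uf_basicC.
- move=> x y xy; apply: contrapT => nxy; move/eqP: xy; apply; apply: uf_sub_eq => a xa.
  by apply: contrapT => nya; apply: nxy; exists a.
Qed.

(** Naturality is [uf_relP]. *)
Lemma id_ClopUf : idF BAS ~=~ Clop \oF Uf.
Proof.
apply: (@order_transport_nat_iso BAS (idF BAS) (Clop \oF Uf) uf_clop).
- by move=> B; split; [exact: uf_clop_le|exact: uf_clop_surj].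
- move=> A B S sS; apply: eq_rel => a b; rewrite [X in X <-> _]uf_relP//; split.
    by move=> H y [x xa xy]; exact: H xy xa.
  by move=> H x y xy xa; apply: (H y); exists x.
- by apply: semifunctor_comp; [exact: Clop_functor.1|exact: Uf_functor.1].
Qed.

Section Eta.
Context (X : stoneSpace).

Lemma point_uf_ultra (x : X) : is_ultrafilter [set U : clopens X | clopen_set U x].
Proof.
apply/ultrafilter_complP; split; last first.
  by move=> U; case: (pselect (clopen_set U x)); [left|right].
by split=> // U V /clops_leP UV /UV.
Qed.

Definition point_uf (x : X) : ultrafilters (clopens X) := Ultrafilters (point_uf_ultra x).

(** By compactness: if the members of [p] had no common point, finitely many of
    them would already have empty intersection. *)
Lemma point_uf_surj (p : ultrafilters (clopens X)) : exists x, point_uf x = p.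
Proof.
suff [x px] : exists x : X, forall U, uf_set p U -> clopen_set U x.
  by exists x; apply/esym; apply: uf_sub_eq => U /px.
apply: contrapT => /forallNP np.
have [||||V [U [pU VU]] TV] := @compact_induction X setT
  (fun V => exists U, uf_set p U /\ V `&` clopen_set U = set0).
- exact: stone_compact.
- by exists \top%O; split; [exact: uf_top|exact: set0I].
- move=> V V' [U [pU VU]] [U' [pU' VU']]; exists (U `&` U')%O; split.
    exact: uf_meet.
  rewrite -subset0 => x [[Vx|V'x] [Ux U'x]].
    by rewrite -VU.
  by rewrite -VU'.
- move=> x _; have /existsNP [U /not_implyP [pU nUx]] := np x.
  exists (~` U); split=> //; first by apply: closed_openC; case: (clopenP U).
  by exists U; rewrite setICl.
apply: (@uf_bot _ _ p); apply: uf_le pU; apply/clops_leP => x Ux.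
by have : (V `&` U) x; [split=> //; exact: TV|rewrite VU].
Qed.

Lemma point_uf_inj : injective point_uf.
Proof.
move=> x y xy; apply: contrapT => /eqP /(@stone_zero_dimensional X) [U [cU Ux nUy]].
have : uf_set (point_uf x) (Clopens cU) by [].
by rewrite xy.
Qed.

Definition point_rel : Rel X (uf_ob (clop_ob X)) := fun x p => point_uf x = p.

Lemma closed_point_rel : closed_rel point_rel.
Proof.
apply/closed_relP => x p xp.
have [U [Ux pU]] : exists U : clopens X, clopen_set U x /\ ~ uf_set p U.
  apply: contrapT => nU; apply: xp; apply: uf_sub_eq => U Ux.
  by apply: contrapT => pU; apply: nU; exists U.
have [oU _] := clopenP U; have [ob _] := uf_basic_clopen (~` U)%O.
exists U, (uf_basic (~` U)%O); split=> //; first exact/uf_compl.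
by move=> x' p' Ux' /uf_compl p'U; apply: contra_not p'U => <-.
Qed.

End Eta.

(** Unrelated points are separated twice: [x] from the closed set [R^-1[y]] by a
    clopen set [~ U], then [y] from the closed set [R[~ U]]. *)
Lemma point_ufP (X Y : stoneSpace) (R : Rel X Y) x y : closed_rel R ->
  R x y <-> @uf_rel (clop_ob X) (clop_ob Y) (clop_rel R) (point_uf x) (point_uf y).
Proof.
move=> cR; split=> [xy V [U Ux UV]|xy]; first by apply: UV; exists x.
apply: contrapT => nxy.
have [||U [RU nUx]] := @stone_separation_point X (rpreimage R [set y]) x.
- apply: closed_rpreimage => //.
  exact/accessible_closed_set1/hausdorff_accessible/stone_hausdorff.
- by move=> [_ -> ].
have cU : closed (~` U) by apply: open_closedC; case: (clopenP U).
have [||V [RV nVy]] := @stone_separation_point Y (rimage R (~` U)) y.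
- exact: closed_rimage.
- by move=> [x' nUx' x'y]; apply/nUx'/RU; exists y.
by apply: nVy; apply: (xy V); exists (clopC U).
Qed.

Lemma id_UfClop : idF StoneR ~=~ Uf \oF Clop.
Proof.
apply: (@transport_nat_iso StoneR StoneR (idF StoneR) (Uf \oF Clop)
  (fun X => @point_rel X) (fun X => rconv (@point_rel X))).
- by move=> X; exact: closed_point_rel.
- by move=> X; apply: (@closed_rel_conv X (uf_ob (clop_ob X))); exact: closed_point_rel.
- move=> X; apply: eq_rel => x y; split=> [[p [xp yp]]|<-].
    by apply: (@point_uf_inj X); rewrite xp -yp.
  by exists (point_uf x).
- move=> X; apply: eq_rel => p q; split=> [[x [<- <-]]//|<-].
  by have [x xp] := point_uf_surj p; exists x.
- move=> X Y R cR; apply: eq_rel => x y; rewrite [X in X <-> _](point_ufP x y cR).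
  split=> [xy|[q [[p [<- pq]] yq]]]; last by rewrite yq.
  by exists (point_uf y); split=> //; exists (point_uf x).
- by apply: semifunctor_comp; [exact: Uf_functor.1|exact: Clop_functor.1].
Qed.

(** Duality reverses inclusion: a subordination containing both [clop_rel R] and
    [clop_rel T] is dual to a closed relation contained in [R] and in [T]. *)
Lemma sub_join_clop_rel (X Y : stoneSpace) (R T : Rel X Y) :
  closed_rel R -> closed_rel T ->
  @sub_join (clop_ob X) (clop_ob Y) (clop_rel R) (clop_rel T) =
  clop_rel (fun x y => R x y /\ T x y).
Proof.
move=> cR cT; apply: eq_rel => U V; split.
  apply; first exact: clop_rel_subordination.
    by move=> {}U {}V UV y [x Ux [xy _]]; apply: UV; exists x.
  by move=> {}U {}V UV y [x Ux [_ xy]]; apply: UV; exists x.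
move=> UV W sW RW TW; rewrite uf_relP// => p q pq pU.
have [x xp] := point_uf_surj p; have [y yq] := point_uf_surj q.
rewrite -{}xp -{}yq /= in pq pU *; apply: UV; exists x => //; split.
  apply/(point_ufP _ _ cR) => V' [U' pU' UV']; apply: pq; exists U' => //.
  exact: RW.
apply/(point_ufP _ _ cT) => V' [U' pU' UV']; apply: pq; exists U' => //.
exact: TW.
Qed.

(** * The Vietoris constructions *)

Lemma open_vbox (Z : topologicalType) (U : set Z) : open U -> open (vbox U).
Proof.
by move=> oU; apply: (@subbase_open _ (@vsubbase Z)) => //; exists U => //; left.
Qed.

Lemma open_vdia (Z : topologicalType) (U : set Z) : open U -> open (vdia U).
Proof.
by move=> oU; apply: (@subbase_open _ (@vsubbase Z)) => //; exists U => //; right.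
Qed.

Section VietorisClosed.
Context (X Y : stoneSpace) (R : Rel X Y).
Hypothesis cR : closed_rel R.

Definition cl_image (F : closeds X) : closeds Y :=
  Closeds (closed_rimage cR (@closedsP _ F)).

Definition cl_preimage (G : closeds Y) : closeds X :=
  Closeds (closed_rpreimage cR (@closedsP _ G)).

(** If [G] has a point [y] outside [R[F]], a clopen [V] separates [R[F]] from [y];
    the open conditions that [F'] misses [R^-1[~ V]] and that [G'] meets [~ V] keep the
    pair unrelated. *)
Lemma closed_vbox_rel : @closed_rel (vietoris X) (vietoris Y) (vbox_rel R).
Proof.
apply/closed_relP => F G /existsNP [y /not_implyP [Gy nFy]].
have [||V [FV nVy]] := @stone_separation_point Y (cl_image F) y => //.
  exact: closedsP.
have [oV cV] := clopenP V.
have oV' : open (~` V) by exact: closed_openC.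
exists (vbox (~` rpreimage R (~` V))), (vdia (~` V)); split.
- apply/open_vbox/closed_openC/closed_rpreimage => //; exact: open_closedC.
- exact: open_vdia.
- by move=> x Fx [y' nVy' xy']; apply/nVy'/FV; exists x.
- by exists y.
- by move=> F' G' F'V [y' [G'y' nVy']] /(_ _ G'y') [x /F'V nx xy']; apply: nx; exists y'.
Qed.

End VietorisClosed.

(** [vdia_rel R] is the converse of [vbox_rel] for the converse of [R]. *)
Lemma closed_vdia_rel (X Y : stoneSpace) (R : Rel X Y) :
  closed_rel R -> @closed_rel (vietoris X) (vietoris Y) (vdia_rel R).
Proof.
move=> /closed_rel_conv /closed_vbox_rel.
exact: (@closed_rel_conv (vietoris Y) (vietoris X)).
Qed.

Lemma closed_relI (X Y : topologicalType) (R T : Rel X Y) :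
  closed_rel R -> closed_rel T -> closed_rel (fun x y => R x y /\ T x y).
Proof. exact: closedI. Qed.

(** In each composition below the intermediate closed set is the extreme one:
    [R[F]] for [VBox], [T^-1[H]] for [VDia], and their intersection for [VR]. *)
Lemma VBox_semifunctor : is_semifunctor VBox.
Proof.
split=> [X Y R cR|X Y Z R T cR cT]; first exact: closed_vbox_rel.
apply: eq_rel => F H; split.
  move=> HF; exists (cl_image cR F); split=> // z /HF [x Fx [y [xy yz]]].
  by exists y => //; exists x.
move=> [G [FG GH]] z /GH [y /FG [x Fx xy] yz].
by exists x => //; exists y.
Qed.

Lemma VDia_semifunctor : is_semifunctor VDia.
Proof.
split=> [X Y R cR|X Y Z R T cR cT]; first exact: closed_vdia_rel.
apply: eq_rel => F H; split.
  move=> FH; exists (cl_preimage cT H); split=> // x /FH [z Hz [y [xy yz]]].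
  by exists y => //; exists z.
move=> [G [FG GH]] x /FG [y /GH [z Hz yz] xy].
by exists z => //; exists y.
Qed.

Lemma VR_functor : is_functor VR.
Proof.
split; last first.
  move=> X; apply: eq_rel => F G; split.
    move=> [GF FG]; apply: closeds_inj; apply/seteqP; split=> x.
      by move=> /FG [y Gy ->].
    by move=> /GF [y Fy <-].
  by move=> <-; split=> x Fx; exists x.
split=> [X Y R cR|X Y Z R T cR cT].
  by apply: closed_relI; [exact: closed_vbox_rel|exact: closed_vdia_rel].
apply: eq_rel => F H; split; last first.
  move=> [G [[GF FG] [HG GH]]]; split.
    by move=> z /HG [y /GF [x Fx xy] yz]; exists x => //; exists y.
  by move=> x /FG [y /GH [z Hz yz] xy]; exists z => //; exists y.
move=> [HF FH].
have cG := closedI (@closedsP _ (cl_image cR F)) (@closedsP _ (cl_preimage cT H)).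
exists (Closeds cG); split; split.
- by move=> y [].
- move=> x Fx; have [z Hz [y [xy yz]]] := FH _ Fx.
  by exists y => //; split; [exists x|exists z].
- move=> z Hz; have [x Fx [y [xy yz]]] := HF _ Hz.
  by exists y => //; split; [exists x|exists z].
- by move=> y [].
Qed.

(** * Evaluation of presented boolean algebras *)

Section Presented.
Context d (L : ctbDistrLatticeType d) (X : Type) (E : Rel (bterm X) (bterm X)).
Context (v : X -> L).

Fixpoint beval (t : bterm X) : L :=
  match t with
  | BVar x => v x
  | BBot => \bot
  | BTop => \top
  | BMeet s t => beval s `&` beval t
  | BJoin s t => beval s `|` beval t
  | BCompl s => ~` beval s
  end%O.

Hypothesis vE : forall s t, E s t -> beval s = beval t.

Lemma beval_cong s t : bcong E s t -> beval s = beval t.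
Proof.
elim=> {s t} //=.
- by move=> s t u _ -> _ ->.
- by move=> s s' t t' _ -> _ ->.
- by move=> s s' t t' _ -> _ ->.
- by move=> s s' _ ->.
- by move=> s t; exact: meetC.
- by move=> s t; exact: joinC.
- by move=> s t u; exact: meetA.
- by move=> s t u; exact: joinA.
- by move=> s t; rewrite joinKI.
- by move=> s t; rewrite joinC meetC meetUK.
- by move=> s t u; exact: meetUl.
- by move=> s; exact: join0x.
- by move=> s; exact: meetx1.
- by move=> s; exact: joinxC.
- by move=> s; exact: meetxC.
Qed.

(** The homomorphism induced by the valuation [v], computed on the chosen
    representative of a class; [plift_cls] replaces it by any other. *)
Definition plift (x : presented E) : L := beval (prepr x).

Lemma plift_cls s : plift (pcls E s) = beval s.
Proof. exact/beval_cong/pcls_repr. Qed.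

Lemma plift0 : plift \bot%O = \bot%O.
Proof. exact: plift_cls. Qed.

Lemma plift1 : plift \top%O = \top%O.
Proof. exact: plift_cls. Qed.

Lemma pliftI x y : plift (x `&` y)%O = (plift x `&` plift y)%O.
Proof.
elim/pcls_ind: x => s; elim/pcls_ind: y => t.
by rewrite [(pcls E s `&` _)%O]pmeetE !plift_cls.
Qed.

Lemma pliftU x y : plift (x `|` y)%O = (plift x `|` plift y)%O.
Proof.
elim/pcls_ind: x => s; elim/pcls_ind: y => t.
by rewrite [(pcls E s `|` _)%O]pjoinE !plift_cls.
Qed.

Lemma pliftC x : plift (~` x)%O = (~` plift x)%O.
Proof.
by elim/pcls_ind: x => s; rewrite [(~` _)%O in LHS]pcomplE !plift_cls.
Qed.

End Presented.

(** * Normal forms in [kalg B] *)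

Lemma joins_meetl d (L : tbDistrLatticeType d) (I : Type) (r : seq I)
    (F : I -> L) y :
  ((\join_(i <- r) F i) `&` y = \join_(i <- r) (F i `&` y))%O.
Proof.
by apply: (big_morph (fun x => x `&` y)%O) => [x x'|]; [exact: meetUl|exact: meet0x].
Qed.

Lemma joins_meetr d (L : tbDistrLatticeType d) (I : Type) (r : seq I)
    (F : I -> L) y :
  (y `&` (\join_(i <- r) F i) = \join_(i <- r) (y `&` F i))%O.
Proof.
by apply: (big_morph (fun x => y `&` x)%O) => [x x'|]; [exact: meetUr|exact: meetx0].
Qed.

Section KAlg.
Context (B : boolAlg).
Local Notation box := (@kbox B).
Local Notation dia := (@kdia B).
Implicit Types (a b c : B) (x y : kalg B).
Local Open Scope order_scope.

Let cls (t : bterm (kgen B)) : kalg B := pcls (@krel B) t.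

Let clsI s t : cls (BMeet s t) = cls s `&` cls t.
Proof. by apply/esym; exact: pmeetE. Qed.

Let clsU s t : cls (BJoin s t) = cls s `|` cls t.
Proof. by apply/esym; exact: pjoinE. Qed.

Let clsC s : cls (BCompl s) = ~` cls s.
Proof. by apply/esym; exact: pcomplE. Qed.

Let cls_krel s t : krel s t -> cls s = cls t.
Proof. by move=> st; apply/pcls_eq/BC_ax. Qed.

Lemma kbox_top : box \top = \top.
Proof. exact: (cls_krel (KR_box1 B)). Qed.

Lemma kdia_bot : dia \bot = \bot.
Proof. exact: (cls_krel (KR_dia0 B)). Qed.

Lemma kboxI a b : box (a `&` b) = box a `&` box b.
Proof. by rewrite -[RHS]clsI; exact: (cls_krel (KR_boxI a b)). Qed.

Lemma kdiaU a b : dia (a `|` b) = dia a `|` dia b.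
Proof. by rewrite -[RHS]clsU; exact: (cls_krel (KR_diaU a b)). Qed.

Lemma kboxU a b : box (a `|` b) <= box a `|` dia b.
Proof.
by apply/meet_idPl; have := cls_krel (KR_boxU a b); rewrite clsI clsU.
Qed.

Lemma kdiaI a b : box a `&` dia b <= dia (a `&` b).
Proof.
by apply/meet_idPl; have := cls_krel (KR_diaI a b); rewrite !clsI.
Qed.

Lemma kbox_le a b : a <= b -> box a <= box b.
Proof. by move=> /meet_idPl ab; rewrite -ab kboxI leIr. Qed.

Lemma kdia_le a b : a <= b -> dia a <= dia b.
Proof. by move=> /join_idPl <-; rewrite kdiaU leUr. Qed.

(** The last two families of relations say that [box a] and [dia (~` a)] have
    meet [\bot] and join [\top]. *)
Lemma kboxC a : ~` box a = dia (~` a).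
Proof.
apply/le_anti/andP; split; last first.
  by rewrite -disj_leC -lex0 meetC -kdia_bot -(meetxC a) kdiaI.
rewrite -[X in _ <= X]complK -disj_leC -complU -compl1 (inj_eq compl_inj).
by rewrite -le1x -kbox_top -(joinxC a) kboxU.
Qed.

Lemma kdiaC a : ~` dia a = box (~` a).
Proof. by rewrite -{1}[a]complK -kboxC complK. Qed.

Lemma kbox_dia a b : box a `&` dia b = box a `&` dia (a `&` b).
Proof.
apply/le_anti; rewrite !lexI leIl kdiaI leIl /=.
by apply: le_trans (leIr _ _) _; exact/kdia_le/leIr.
Qed.

Definition kterm (p : B * seq B) : kalg B := box p.1 `&` \meet_(b <- p.2) dia b.

Definition has_dnf x := exists s, is_dnf x s.

Lemma has_dnf0 : has_dnf \bot.
Proof. by exists [::]; split=> //; rewrite big_nil. Qed.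

Lemma has_dnfU x y : has_dnf x -> has_dnf y -> has_dnf (x `|` y).
Proof.
move=> [s [sP ->]] [t [tP ->]]; exists (s ++ t); split; last by rewrite big_cat.
by move=> p b; rewrite mem_cat => /orP [/sP|/tP]; exact.
Qed.

Lemma kterm_restrict a bs : kterm (a, bs) = kterm (a, [seq a `&` b | b <- bs]).
Proof.
rewrite /kterm /=; elim: bs => [|b bs IH] /=; first by rewrite !big_nil.
by rewrite !big_cons !meetA -kbox_dia ![_ `&` dia _]meetC -!meetA IH.
Qed.

(** The arguments of the diamonds are cut down to [a]; if one of them becomes
    [\bot], then [kdia_bot] makes the whole term [\bot], which is the empty
    join. *)
Lemma has_dnf_kterm p : has_dnf (kterm p).
Proof.
case: p => a bs; rewrite kterm_restrict; set bs' := map _ _.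
have [b0|nb0] := boolP (\bot \in bs').
  suff -> : kterm (a, bs') = \bot by exact: has_dnf0.
  apply/eqP; rewrite -lex0 /kterm /=; apply: le_trans (leIr _ _) _.
  by rewrite -kdia_bot; exact: meets_inf_seq.
exists [:: (a, bs')]; split; last by rewrite big_seq1.
move=> p b; rewrite inE => /eqP -> /= bbs; split.
  by move=> b0; move: nb0; rewrite -b0 bbs.
by case/mapP: bbs => c _ ->; exact: leIl.
Qed.

Lemma has_dnfI x y : has_dnf x -> has_dnf y -> has_dnf (x `&` y).
Proof.
move=> [s [_ ->]] [t [_ ->]]; rewrite joins_meetl.
elim/big_ind: _ => [||p _]; [exact: has_dnf0|exact: has_dnfU|].
rewrite joins_meetr.
elim/big_ind: _ => [||q _]; [exact: has_dnf0|exact: has_dnfU|].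
suff -> : box p.1 `&` \meet_(b <- p.2) dia b `&`
    (box q.1 `&` \meet_(b <- q.2) dia b) = kterm (p.1 `&` q.1, p.2 ++ q.2).
  exact: has_dnf_kterm.
by rewrite /kterm /= kboxI big_cat /= meetACA.
Qed.

Lemma has_dnf_box a : has_dnf (box a).
Proof.
have -> : box a = kterm (a, [::]) by rewrite /kterm big_nil meetx1.
exact: has_dnf_kterm.
Qed.

Lemma has_dnf_dia a : has_dnf (dia a).
Proof.
have -> : dia a = kterm (\top, [:: a]) by rewrite /kterm big_seq1 kbox_top meet1x.
exact: has_dnf_kterm.
Qed.

(** Treating an element together with its complement makes the induction pass
    through complements, down to the generators, where [kboxC] and
    [kdiaC] apply. *)
Lemma kalg_dnf x : has_dnf x.
Proof.
suff [] : has_dnf x /\ has_dnf (~` x) by [].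
have dnf1 : has_dnf \top by rewrite -kbox_top; exact: has_dnf_box.
elim/pcls_ind: x; elim=> [[a|a]|||s [s0 s1] t [t0 t1]|s [s0 s1] t [t0 t1]|s [s0 s1]].
- by split; [exact: has_dnf_box|rewrite kboxC; exact: has_dnf_dia].
- by split; [exact: has_dnf_dia|rewrite kdiaC; exact: has_dnf_box].
- by rewrite -[pcls _ _]/(\bot : kalg B) compl0; split=> //; exact: has_dnf0.
- by rewrite -[pcls _ _]/(\top : kalg B) compl1; split=> //; exact: has_dnf0.
- rewrite -/(cls _) clsI complI; split; [exact: has_dnfI|exact: has_dnfU].
- rewrite -/(cls _) clsU complU; split; [exact: has_dnfU|exact: has_dnfI].
- by rewrite -/(cls _) clsC complK; split.
Qed.

Lemma kalg_cnf x : exists t, is_cnf x t.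
Proof.
have [s [sP xE]] := kalg_dnf (~` x).
exists [seq (~` p.1, [seq ~` b | b <- p.2]) | p <- s]; split.
  move=> _ _ /mapP [p ps ->] /mapP [b bp ->] /=.
  have [b0 bp1] := sP _ _ ps bp; rewrite leC; split=> //.
  by rewrite -compl0 => /compl_inj.
rewrite -[LHS]complK xE compl_joins big_map; apply: eq_bigr => p _ /=.
rewrite complI kboxC compl_meets big_map; congr (_ `|` _).
by apply: eq_bigr => b _; rewrite kdiaC.
Qed.

End KAlg.

(** * [kalg B] as the clopen algebra of a Vietoris space *)

Section Valuation.
Context (B : boolAlg).
Local Notation VU := (vietoris (uf_ob B)).

Lemma vbox_clopen (X : stoneSpace) (U : set X) : clopen U -> clopen (vbox U).
Proof.
move=> /(clopenC set0) /vdia_clopen /(clopenC set0).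
by rewrite vdiaC setCK.
Qed.

Definition kgen_val (g : kgen B) : clopens VU :=
  match g with
  | KBoxGen a => Clopens (vbox_clopen (X := uf_ob B) (uf_basic_clopen a))
  | KDiaGen a => Clopens (vdia_clopen (X := uf_ob B) (uf_basic_clopen a))
  end.

(** Soundness of the six families of relations for closed sets of ultrafilters. *)
Lemma kgen_val_krel s t : krel s t -> beval kgen_val s = beval kgen_val t.
Proof.
case=> {s t} => [||a b|a b|a b|a b]; apply: clopens_inj; apply/seteqP; split=> F //=.
- by move=> _ x _; exact: uf_top.
- by move=> [x [_ /uf_bot]].
- by move=> Fab; split=> x /Fab; apply: uf_le; rewrite ?leIl ?leIr.
- by move=> [Fa Fb] x Fx; apply: uf_meet; [exact: Fa|exact: Fb].
- by move=> [x [Fx /uf_join [xa|xb]]]; [left|right]; exists x.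
- by case=> -[x [Fx xa]]; exists x; split=> //; apply/uf_join; [left|right].
- by case.
- move=> Fab; split=> //.
  have [[x [Fx xb]]|nFb] := pselect (vdia (uf_basic b) F); first by right; exists x.
  left=> x Fx; have /uf_join[//|xb] := Fab _ Fx.
  by case: nFb; exists x.
- by case.
- move=> [Fa [x [Fx xb]]]; split; first by split=> //; exists x.
  by exists x; split=> //; apply: uf_meet => //; exact: Fa.
Qed.

Definition kval (x : kalg B) : clopens VU := plift kgen_val x.

Let kvE := kgen_val_krel.

Lemma kval_box a : kval (kbox a) = kgen_val (KBoxGen a).
Proof. exact: (plift_cls kvE). Qed.

Lemma kval_dia a : kval (kdia a) = kgen_val (KDiaGen a).
Proof. exact: (plift_cls kvE). Qed.

Lemma kval_meets (I : eqType) (r : seq I) (f : I -> kalg B) (F : VU) :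
  clopen_set (kval (\meet_(i <- r) f i)%O) F <->
  forall i, i \in r -> clopen_set (kval (f i)) F.
Proof.
elim: r => [|i r IH]; first by rewrite big_nil /kval (plift1 kvE).
rewrite big_cons /kval (pliftI kvE) -/(kval _); split.
  by move=> [Fi /IH Fr] j; rewrite inE => /predU1P[->//|]; exact: Fr.
move=> Fr; split; first by apply: Fr; rewrite mem_head.
by apply/IH => j jr; apply: Fr; rewrite inE jr orbT.
Qed.

Lemma kval_joins (I : eqType) (r : seq I) (f : I -> kalg B) (F : VU) :
  clopen_set (kval (\join_(i <- r) f i)%O) F <->
  exists2 i, i \in r & clopen_set (kval (f i)) F.
Proof.
elim: r => [|i r IH]; first by rewrite big_nil /kval (plift0 kvE); split=> // -[].
rewrite big_cons /kval (pliftU kvE) -/(kval _); split.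
  move=> [Fi|/IH [j jr Fj]]; first by exists i; rewrite ?mem_head.
  by exists j; rewrite ?inE ?jr ?orbT.
move=> [j]; rewrite inE => /predU1P[->|jr] Fj; first by left.
by right; apply/IH; exists j.
Qed.

Lemma kval_dnf x s F : is_dnf x s ->
  clopen_set (kval x) F <-> exists2 p, p \in s &
    closed_set F `<=` uf_basic p.1 /\
    forall b, b \in p.2 -> exists2 u, closed_set F u & uf_set u b.
Proof.
move=> [_ ->]; rewrite kval_joins; split=> -[p ps].
  rewrite /kval (pliftI kvE) -/(kval _) => -[+ /kval_meets Fb].
  rewrite kval_box => Fa; exists p => //; split=> // b /Fb.
  by rewrite kval_dia => -[u []]; exists u.
move=> [Fa Fb]; exists p => //; rewrite /kval (pliftI kvE) -/(kval _).
split; first by rewrite kval_box.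
by apply/kval_meets => b /Fb [u Fu ub]; rewrite kval_dia; exists u.
Qed.

Lemma kval_cnf y t G : is_cnf y t ->
  clopen_set (kval y) G <-> forall q, q \in t ->
    (exists2 v, closed_set G v & uf_set v q.1) \/
    exists2 d, d \in q.2 & closed_set G `<=` uf_basic d.
Proof.
move=> [_ ->]; rewrite kval_meets; split=> H q /H.
  rewrite /kval (pliftU kvE) -/(kval _) => -[|/kval_joins [d dq]].
    by rewrite kval_dia => -[v []]; left; exists v.
  by rewrite kval_box; right; exists d.
move=> H'; rewrite /kval (pliftU kvE) -/(kval _); case: H' => [[v Gv vc]|[d dq Gd]].
  by left; rewrite kval_dia; exists v.
by right; apply/kval_joins; exists d => //; rewrite kval_box.
Qed.

(** By [clopen_surj], since diamonds of clopen sets, with their complements,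
    separate the closed sets. *)
Lemma kval_surj U : exists x, kval x = U.
Proof.
apply: (@clopen_surj VU).
- exact: (plift0 kvE).
- exact: (pliftU kvE).
- exact: (pliftC kvE).
move=> F G FG; apply: contrapT => nFG; move/eqP: FG; apply.
apply: closeds_inj.
have dia a : (exists2 u, closed_set F u & uf_set u a) <->
    exists2 u, closed_set G u & uf_set u a.
  split=> -[u Fu ua].
    apply: contrapT => Ga; apply: nFG; exists (kdia a); rewrite kval_dia; split.
      by exists u.
    by move=> [v [Gv va]]; apply: Ga; exists v.
  apply: contrapT => Fa; apply: nFG; exists (kbox (~` a)%O); rewrite kval_box; split.
    by move=> v Fv; apply/uf_compl => va; apply: Fa; exists v.
  by move=> /(_ u Fu) /uf_compl.
have sub (H H' : closeds (uf_ob B)) :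
    (forall a, (exists2 u, closed_set H u & uf_set u a) ->
      exists2 u, closed_set H' u & uf_set u a) -> closed_set H `<=` closed_set H'.
  move=> HH' u Hu; apply: contrapT => nH'u.
  have [|U' [H'U nUu]] := @stone_separation_point (uf_ob B) H' u _ nH'u.
    exact: closedsP.
  have [a aU] := uf_clop_surj (clopC U').
  have [|v H'v va] := HH' a; last first.
    have : clopen_set (uf_clop a) v by [].
    by rewrite aU; apply; exact: H'U.
  exists u => //; suff : clopen_set (uf_clop a) u by [].
  by rewrite aU.
by apply/seteqP; split; apply: sub => a /dia.
Qed.

End Valuation.

Definition cl_basic (C : boolAlg) (a : C) : closeds (uf_ob C) :=
  Closeds (uf_basic_clopen a).2.

Lemma nonbot_point (C : boolAlg) (b : C) :
  b <> \bot%O -> exists u : ultrafilters C, uf_set u b.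
Proof.
move=> b0; have [|u [ub _]] := @uf_le_separation _ C b \bot%O; last by exists u.
by rewrite lex0 => /eqP.
Qed.

Lemma nontop_point (C : boolAlg) (b : C) :
  b <> \top%O -> exists u : ultrafilters C, ~ uf_set u b.
Proof.
move=> b0; have [|u [_ ub]] := @uf_le_separation _ C \top%O b; last by exists u.
by rewrite le1x => /eqP.
Qed.

(** By normal forms it suffices to compare a disjunct [p] of [x] with a conjunct
    [q] of [y].  The closed set [p.1 /\ ~ q.1] satisfies [p] unless some [b] in
    [p.2] is below [q.1]; if it satisfies [q], it is included in some [d] in
    [q.2], and then so is [p.1] because [q.1 <= d].  In the two cases the
    inequality between [p] and [q] follows from monotonicity of [kdia] or
    [kbox]. *)
Lemma kval_le (B : boolAlg) (x y : kalg B) : (kval x <= kval y)%O = (x <= y)%O.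
Proof.
apply/idP/idP; last first.
  move=> /join_idPl <-; rewrite /kval (pliftU (@kgen_val_krel B)).
  exact: leUr.
move=> /clops_leP xy.
have [s xs] := kalg_dnf x; have [t yt] := kalg_cnf y.
rewrite xs.2 yt.2 /=.
rewrite big_seq; apply/joins_le => p ps; rewrite [X in (_ <= X)%O]big_seq.
apply/meets_ge => q qt.
have cF := closedI (@closedsP _ (cl_basic p.1)) (@closedsP _ (cl_basic (~` q.1)%O)).
have [[b bp bc]|nb] := pselect (exists2 b, b \in p.2 & (b <= q.1)%O).
  apply: le_trans (leIr _ _) (le_trans _ (leUl _ _)).
  by apply: (le_trans (y := kdia b)); [exact: meets_inf_seq|exact: kdia_le].
have : clopen_set (kval y) (Closeds cF).
  apply/xy/(kval_dnf _ xs); exists p => //; split; first by move=> u [].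
  move=> b bp; have [|u [ub nuc]] := @uf_le_separation _ B b q.1.
    by move=> bc; apply: nb; exists b.
  exists u => //; split; last exact/uf_compl.
  by apply: uf_le ub; case: (xs.1 _ _ ps bp).
move=> /(kval_cnf _ yt) /(_ _ qt) [[v [_ /uf_compl //]]|[d dq Fd]].
apply: le_trans (leIl _ _) (le_trans _ (leUr _ _)).
apply: (le_trans (y := kbox d)); last exact: joins_sup_seq.
apply: kbox_le; apply: contrapT => /uf_le_separation [u [ua nud]].
apply/nud/Fd; split=> //; apply/uf_compl; apply: contra_not nud; apply: uf_le.
by case: (yt.1 _ _ qt dq).
Qed.

Lemma kval_iso (B : boolAlg) :
  @order_iso (kalg B) (clop_ob (vietoris (uf_ob B))) (@kval B).
Proof. by split; [exact: kval_le|exact: kval_surj]. Qed.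

(** * The relations between the algebras [kalg] and their duals *)

Definition kpull (A B : boolAlg) :=
  @pull_rel (kalg A) (clop_ob (vietoris (uf_ob A))) (kalg B)
    (clop_ob (vietoris (uf_ob B))) (@kval A) (@kval B).

Section Semantics.
Context (A B : boolAlg) (S : Rel A B).
Hypothesis sS : subordination S.
Local Notation R := (@uf_rel A B S).

Let cR : @closed_rel (uf_ob A) (uf_ob B) R.
Proof. exact: closed_uf_rel. Qed.

(** A witness [d] of [S p.1 d] forces [G] inside [d] for every [G] included in
    the image of a set satisfying [p].  For the converse, the set [p.1] satisfies
    [p], since the [b] in [p.2] are nonzero and below [p.1], and it is related to
    [G], the part of [R[p.1]] outside [q.1].  As [G] misses [q.1], it satisfies
    [q] only by lying in some [d], and then [S p.1 d] by [uf_rel_separation]. *)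
Lemma kbox_relP_dnf x y s t : is_dnf x s -> is_cnf y t ->
  clop_rel (X := vietoris (uf_ob A)) (Y := vietoris (uf_ob B))
    (vbox_rel R) (kval x) (kval y) <->
  forall p q, p \in s -> q \in t -> exists2 d, d \in q.2 & S p.1 d.
Proof.
move=> xs yt; split=> [xy p q ps qt|H G [F /(kval_dnf _ xs) [p ps [Fa _]] GF]]; last first.
  apply/(kval_cnf _ yt) => q qt; right; have [d dq ad] := H _ _ ps qt.
  by exists d => // v /GF [u /Fa ua uv]; apply: uv; exists p.1.
pose G := Closeds (closedI (@closedsP _ (cl_image cR (cl_basic p.1)))
  (@closedsP _ (cl_basic (~` q.1)%O))).
have /(kval_cnf _ yt) : clopen_set (kval y) G.
  apply: xy; exists (cl_basic p.1); last by move=> v [].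
  apply/(kval_dnf _ xs); exists p => //; split=> // b bp.
  have [/nonbot_point [u ub] bp1] := xs.1 _ _ ps bp.
  by exists u => //; exact: uf_le ub.
move=> /(_ _ qt) [[v [_ /uf_compl //]]|[d dq Gd]]; exists d => //.
apply: contrapT => /(uf_rel_separation sS) [u [v [uv ua nvd]]].
apply/nvd/Gd; split; first by exists u.
apply/uf_compl; apply: contra_not nvd; apply: uf_le.
by case: (yt.1 _ _ qt dq).
Qed.

(** Dual to [kbox_relP_dnf], with [G] the complement of [q.1] and [F] the part of
    [p.1] related to [G].  Here [G] violates [q]: it misses [q.1], and it lies in
    no [d], since [d] is not the top element and contains [q.1].  So [F] cannot
    satisfy [p], although it meets every [b] in [p.2] that [S] does not relate to
    [q.1]. *)
Lemma kdia_relP_dnf x y s t : is_dnf x s -> is_cnf y t ->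
  clop_rel (X := vietoris (uf_ob A)) (Y := vietoris (uf_ob B))
    (vdia_rel R) (kval x) (kval y) <->
  forall p q, p \in s -> q \in t -> exists2 b, b \in p.2 & S b q.1.
Proof.
move=> xs yt; split=> [xy p q ps qt|H G [F /(kval_dnf _ xs) [p ps [_ Fb]] FG]]; last first.
  apply/(kval_cnf _ yt) => q qt; left; have [b bp bc] := H _ _ ps qt.
  have [u Fu ub] := Fb _ bp; have [v Gv uv] := FG _ Fu.
  by exists v => //; apply: uv; exists b.
apply: contrapT => nbc; have {}nbc b : b \in p.2 -> ~ S b q.1.
  by move=> bp bc; apply: nbc; exists b.
pose G := cl_basic (~` q.1)%O.
pose F := Closeds (closedI (@closedsP _ (cl_basic p.1)) (@closedsP _ (cl_preimage cR G))).
have : clopen_set (kval y) G.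
  apply: xy; exists F; last by move=> u [].
  apply/(kval_dnf _ xs); exists p => //; split; first by move=> u [].
  move=> b bp; have [u [v [uv ub nvc]]] := uf_rel_separation sS (nbc _ bp).
  exists u => //; split; last by exists v => //; exact/uf_compl.
  by apply: uf_le ub; case: (xs.1 _ _ ps bp).
move=> /(kval_cnf _ yt) /(_ _ qt) [[v /uf_compl //]|[d dq Gd]].
have [cd /nontop_point [v nvd]] := yt.1 _ _ qt dq.
apply/nvd/Gd/uf_compl; apply: contra_not nvd; exact: uf_le.
Qed.

Lemma kbox_relE : kbox_rel S = kpull (clop_rel (vbox_rel R)).
Proof.
apply: eq_rel => x y; split=> [[s [t [xs yt st]]]|].
  exact/(kbox_relP_dnf xs yt).
have [s xs] := kalg_dnf x; have [t yt] := kalg_cnf y.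
by move=> /(kbox_relP_dnf xs yt) st; exists s, t.
Qed.

Lemma kdia_relE : kdia_rel S = kpull (clop_rel (vdia_rel R)).
Proof.
apply: eq_rel => x y; split=> [[s [t [xs yt st]]]|].
  exact/(kdia_relP_dnf xs yt).
have [s xs] := kalg_dnf x; have [t yt] := kalg_cnf y.
by move=> /(kdia_relP_dnf xs yt) st; exists s, t.
Qed.

Lemma kS_relE : kS_rel S = kpull (clop_rel (vEM_rel R)).
Proof.
rewrite /kS_rel kbox_relE kdia_relE sub_join_pull; [|exact: kval_iso|exact: kval_iso].
by rewrite sub_join_clop_rel//; [exact: closed_vbox_rel|exact: closed_vdia_rel].
Qed.

End Semantics.

(** * Transport from [V] to [K] *)

(** The three pairs of constructions differ only in their action on morphisms,
    hence the common treatment: a semi-functor [V] built on the Vietoris space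
    and an operation [K] that corresponds to it through [kval]. *)
Section Assembly.
Context (vmor : forall X Y : stoneSpace, Rel X Y -> Rel (vietoris X) (vietoris Y)).
Context (kmor : forall A B : boolAlg, Rel A B -> Rel (kalg A) (kalg B)).

Let V : fdata StoneR StoneR := @FData StoneR StoneR vietoris vmor.
Let K : fdata BAS BAS := @FData BAS BAS kalg kmor.

Hypothesis sV : is_semifunctor V.
Hypothesis KE : forall (A B : boolAlg) (S : Rel A B), subordination S ->
  kmor S = kpull (clop_rel (vmor (uf_rel S : Rel (uf_ob A) (uf_ob B)))).

Let sC := Clop_functor.1.
Let sU := Uf_functor.1.
Let sid (C : relCat) : is_semifunctor (idF C). Proof. by split. Qed.
Let sCV : is_semifunctor (Clop \oF V). Proof. exact: semifunctor_comp. Qed.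
Let sVU : is_semifunctor (V \oF Uf). Proof. exact: semifunctor_comp. Qed.
Let sUC : is_semifunctor (Uf \oF Clop). Proof. exact: semifunctor_comp. Qed.
Let sCVU : is_semifunctor (Clop \oF V \oF Uf).
Proof. exact: (semifunctor_comp sCV sU). Qed.

Lemma kalg_semifunctor : is_semifunctor K.
Proof. exact: (@order_transport_semifunctor BAS K (Clop \oF V \oF Uf) (@kval)
  kval_iso KE sCVU). Qed.

Lemma kalg_functor : is_functor V -> is_functor K.
Proof.
move=> fV; apply: (@order_transport_functor BAS K (Clop \oF V \oF Uf) (@kval)
  kval_iso KE sCVU).
exact: (functor_comp (functor_comp Clop_functor fV) Uf_functor).
Qed.

Let KV : K ~=~ Clop \oF V \oF Uf.
Proof. exact: (@order_transport_nat_iso BAS K (Clop \oF V \oF Uf) (@kval)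
  kval_iso KE sCVU). Qed.

Lemma Clop_nat_iso : Clop \oF V ~=~ K \oF Clop.
Proof.
apply: nat_iso_trans (_ : Clop \oF V \oF (Uf \oF Clop) ~=~ _).
  exact: (nat_iso_whiskerl sCV (sid _) sUC id_UfClop).
apply: nat_iso_sym.
exact: (nat_iso_whiskerr sC kalg_semifunctor sCVU KV).
Qed.

Lemma Uf_nat_iso : Uf \oF K ~=~ V \oF Uf.
Proof.
apply: nat_iso_trans (nat_iso_whiskerl sU kalg_semifunctor sCVU KV) _.
apply: nat_iso_sym.
exact: (nat_iso_whiskerr sVU (sid _) sUC id_UfClop).
Qed.

End Assembly.

Theorem theorem7p3 :
  (is_functor Clop /\ is_functor Uf) /\
  (is_semifunctor VBox /\ is_semifunctor VDia /\ is_functor VR) /\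
  (is_semifunctor KBox /\ is_semifunctor KDia /\ is_functor KS) /\
  (Clop \oF VBox ~=~ KBox \oF Clop /\ Uf \oF KBox ~=~ VBox \oF Uf) /\
  (Clop \oF VDia ~=~ KDia \oF Clop /\ Uf \oF KDia ~=~ VDia \oF Uf) /\
  (Clop \oF VR ~=~ KS \oF Clop /\ Uf \oF KS ~=~ VR \oF Uf).
Proof.
have [sVR _] := VR_functor.
have sVB := VBox_semifunctor; have sVD := VDia_semifunctor.
split; first by split; [exact: Clop_functor|exact: Uf_functor].
split; first by split=> //; split=> //; exact: VR_functor.
split.
  split; first exact: (kalg_semifunctor sVB kbox_relE).
  split; first exact: (kalg_semifunctor sVD kdia_relE).
  exact: (kalg_functor sVR kS_relE VR_functor).
split.
  by split; [exact: (Clop_nat_iso sVB kbox_relE)|exact: (Uf_nat_iso sVB kbox_relE)].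
split.
  by split; [exact: (Clop_nat_iso sVD kdia_relE)|exact: (Uf_nat_iso sVD kdia_relE)].
by split; [exact: (Clop_nat_iso sVR kS_relE)|exact: (Uf_nat_iso sVR kS_relE)].
Qed.
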